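(* Let $A$ be an $N \times n$ random matrix ($N \ge n$) whose columns $A_1,\dots,A_n$ are independent sub-gaussian isotropic random vectors in $\mathbb{R}^N$ with $\|A_j\|_2 = \sqrt{N}$ almost surely for all $j$. Then for every $t \ge 0$, the inequality $$\sqrt{N} - C\sqrt{n} - t \le s_{\min}(A) \le s_{\max}(A) \le \sqrt{N} + C\sqrt{n} + t$$ holds with probability at least $1 - 2\exp(-ct^2)$, where $C = C'_K > 0$ and $c = c'_K > 0$ depend only on the sub-gaussian norm $K = \max_j \|A_j\|_{\psi_2}$ of the columns.
   Context: All matrices are real. For an $N \times n$ matrix $A$, the singular values $s_1(A) \ge \dots \ge s_n(A) \ge 0$ are the eigenvalues of $\sqrt{A^*A}$; $s_{\max}(A) = s_1(A)$ and $s_{\min}(A) = s_n(A)$. A random vector $X$ in $\mathbb{R}^N$ is isotropic if $\mathbb{E}\, XX^T = I$, equivalently $\mathbb{E}\langle X,x\rangle^2 = \|x\|_2^2$ for all $x \in \mathbb{R}^N$ (no centering is assumed). The sub-gaussian norm of a random variable $Z$ is $\|Z\|_{\psi_2} = \sup_{p \ge 1} p^{-1/2} (\mathbb{E}|Z|^p)^{1/p}$, and $Z$ is sub-gaussian if this is finite. A random vector $X$ in $\mathbb{R}^N$ is sub-gaussian if $\langle X,x\rangle$ is sub-gaussian for every $x\in\mathbb{R}^N$, and $\|X\|_{\psi_2} = \sup_{x \in S^{N-1}} \|\langle X,x\rangle\|_{\psi_2}$, where $S^{N-1}$ is the unit Euclidean sphere. *)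

(* Defs.v *)
From HB Require Import structures.
From mathcomp Require Import all_boot all_order all_algebra.
From mathcomp Require Import all_classical all_reals all_analysis.

Set Implicit Arguments.
Unset Strict Implicit.
Unset Printing Implicit Defensive.

Import Order.TTheory GRing.Theory Num.Theory.

Local Open Scope classical_set_scope.
Local Open Scope ring_scope.

(** ** Euclidean structure on R^N (column vectors).
    The norm that the library puts on matrices is the sup norm, so the
    Euclidean norm is defined here. *)

Definition dotv (R : realType) (N : nat) (x y : 'cV[R]_N) : R :=
  \sum_(i < N) x i 0 * y i 0.

Definition l2norm (R : realType) (N : nat) (x : 'cV[R]_N) : R :=
  Num.sqrt (dotv x x).

Definition sphere2 (R : realType) (N : nat) : set 'cV[R]_N :=
  [set x | l2norm x = 1].

(** ** Singular values *)

Definition psdmx (R : realType) (n : nat) (B : 'M[R]_n) : Prop :=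
  B^T = B /\ forall x : 'cV[R]_n, 0 <= dotv x (B *m x).

(* The positive semidefinite square root; it exists and is unique when [M] is
   positive semidefinite (the default value 0 is returned otherwise). *)
Definition sqrtmx (R : realType) (n : nat) (M : 'M[R]_n) : 'M[R]_n :=
  xget 0 [set B | psdmx B /\ B *m B = M].

(* The eigenvalues with multiplicity, in nonincreasing order; the sequence
   exists and is unique when the characteristic polynomial splits over [R], in
   particular when [M] is symmetric (the default value [::] is returned
   otherwise). *)
Definition eigenvalues (R : realType) (n : nat) (M : 'M[R]_n) : seq R :=
  xget [::] [set s : seq R | sorted >=%R s /\
                             char_poly M = \prod_(a <- s) ('X - a%:P)].

Definition singular_values (R : realType) (N n : nat) (A : 'M[R]_(N, n)) :
    seq R :=
  eigenvalues (sqrtmx (A^T *m A)).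

(* Positions are counted from 0: s_1 is at position 0, s_n at position n - 1. *)
Definition s_max (R : realType) (N n : nat) (A : 'M[R]_(N, n)) : R :=
  (singular_values A)`_0.

Definition s_min (R : realType) (N n : nat) (A : 'M[R]_(N, n)) : R :=
  (singular_values A)`_n.-1.

(** ** Random matrices and vectors *)

Definition random_matrix d (T : measurableType d) (R : realType) (N n : nat)
    (A : T -> 'M[R]_(N, n)) : Prop :=
  forall i j, measurable_fun [set: T] (fun w => A w i j).

(* The Borel sets of R^N, as the sigma-algebra generated by the coordinates. *)
Definition borelv (R : realType) (N : nat) : set (set 'cV[R]_N) :=
  g_sigma_preimage (fun (i : 'I_N) (x : 'cV[R]_N) => x i 0).

Definition independent_vectors d (T : measurableType d) (R : realType)
    (P : probability T R) (N n : nat) (X : 'I_n -> T -> 'cV[R]_N) : Prop :=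
  forall (J : {set 'I_n}) (B : 'I_n -> set 'cV[R]_N),
    (forall j, j \in J -> borelv (B j)) ->
    P (\bigcap_(j in [set` J]) (X j @^-1` B j)) =
    (\prod_(j in J) P (X j @^-1` B j))%E.

Definition isotropic d (T : measurableType d) (R : realType)
    (P : probability T R) (N : nat) (X : T -> 'cV[R]_N) : Prop :=
  forall i k : 'I_N,
    'E_P[fun w => (X w *m (X w)^T) i k]%E = ((1%:M : 'M[R]_N) i k)%:E.

(** ** Sub-gaussian norms *)

Definition psi2norm d (T : measurableType d) (R : realType)
    (P : probability T R) (Z : T -> R) : \bar R :=
  ereal_sup [set ((p `^ (- 2^-1))%:E * 'N[P]_p%:E[EFin \o Z])%E
            | p in [set p : R | 1 <= p]].

Definition subgaussian d (T : measurableType d) (R : realType)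
    (P : probability T R) (Z : T -> R) : Prop :=
  (psi2norm P Z < +oo)%E.

Definition subgaussian_vector d (T : measurableType d) (R : realType)
    (P : probability T R) (N : nat) (X : T -> 'cV[R]_N) : Prop :=
  forall x : 'cV[R]_N, subgaussian P (fun w => dotv (X w) x).

Definition psi2norm_vector d (T : measurableType d) (R : realType)
    (P : probability T R) (N : nat) (X : T -> 'cV[R]_N) : \bar R :=
  ereal_sup [set psi2norm P (fun w => dotv (X w) x) | x in @sphere2 R N].

(* Main.v *)
Require Import Defs.
From mathcomp Require Import all_boot all_order all_algebra.
From mathcomp Require Import all_classical all_reals all_analysis.
From mathcomp Require Import measurable_realfun.
From mathcomp Require Import complex.
From mathcomp Require Import ring lra.

(** Write [|A x|^2 - N |x|^2] as the sum of the off-diagonal terms [x_j x_k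
    <A_j, A_k>]. By decoupling, this is at most four times the largest [sum_(j
    in S, k notin S) x_j x_k <A_j, A_k>] over sets [S] of columns, hence at most
    [4 |x|] times the norm of the vector of the [<A_j, z>], [j in S], where [z]
    is the part of [A x] coming from the columns outside [S]. These columns are
    independent of the [A_j] with [j in S], so [z] may be frozen; as [E exp(a
    <A_j, e>^2) <= 2] for unit [e], that norm exceeds [u |z|] with probability
    at most [2^n exp(- a u^2)]. A union bound over [S] and over a net of the
    ball with exponentially many points makes this hold simultaneously for all
    of them. The bound is homogeneous in [z], and [|z|] is at most the norm [M]
    of [A], so [M^2 <= N + 8 u M], whence [M <= sqrt N + 8 u] and the two-sided
    estimate for [u = (t + C sqrt n) / 72]. *)

Set Implicit Arguments.
Unset Strict Implicit.
Unset Printing Implicit Defensive.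

Import Order.TTheory GRing.Theory Num.Theory.
Import numFieldNormedType.Exports.

Local Open Scope classical_set_scope.
Local Open Scope ring_scope.

(** * Singular values *)

Section RealSymmetric.
Context {R : realType}.

Lemma dotvE N (x y : 'cV[R]_N) : dotv x y = (x^T *m y) 0 0.
Proof. by rewrite mxE; apply: eq_bigr => i _; rewrite mxE. Qed.

Lemma dotvC N (x y : 'cV[R]_N) : dotv x y = dotv y x.
Proof. by apply: eq_bigr => i _; rewrite mulrC. Qed.

Lemma dotvDl N (x y z : 'cV[R]_N) : dotv (x + y) z = dotv x z + dotv y z.
Proof. by rewrite /dotv -big_split; apply: eq_bigr => i _; rewrite mxE mulrDl. Qed.

Lemma dotvDr N (x y z : 'cV[R]_N) : dotv z (x + y) = dotv z x + dotv z y.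
Proof. by rewrite !(dotvC z) dotvDl. Qed.

Lemma dotvZl N (a : R) (x y : 'cV[R]_N) : dotv (a *: x) y = a * dotv x y.
Proof. by rewrite /dotv mulr_sumr; apply: eq_bigr => i _; rewrite mxE mulrA. Qed.

Lemma dotvZr N (a : R) (x y : 'cV[R]_N) : dotv x (a *: y) = a * dotv x y.
Proof. by rewrite !(dotvC x) dotvZl. Qed.

Lemma dotv_ge0 N (x : 'cV[R]_N) : 0 <= dotv x x.
Proof. by apply: sumr_ge0 => i _; rewrite -expr2 sqr_ge0. Qed.

Lemma dotv_eq0 N (x : 'cV[R]_N) : (dotv x x == 0) = (x == 0).
Proof.
apply/eqP/eqP => [x0|->]; last by apply: big1 => i _; rewrite mxE mulr0.
apply/colP => i; rewrite mxE; apply/eqP.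
have x2 j : true -> 0 <= x j 0 * x j 0 by rewrite -expr2 sqr_ge0.
have /eqP : x i 0 * x i 0 = 0 := psumr_eq0P x2 x0 isT.
by rewrite mulf_eq0 orbb.
Qed.

Lemma dotv_mulmx N n (A : 'M[R]_(N, n)) x y :
  dotv (A *m x) y = dotv x (A^T *m y).
Proof. by rewrite !dotvE trmx_mul mulmxA. Qed.

(** Over the complex numbers [M] is Hermitian, so it has an eigenvalue, and that eigenvalue is real.
    Being a root of the characteristic polynomial descends to [R], which yields a real row
    eigenvector; symmetry turns it into a column. *)
Lemma symmetric_eigenvector n (M : 'M[R]_n.+1) : M^T = M ->
  exists (a : R) (v : 'cV[R]_n.+1), v != 0 /\ M *m v = a *: v.
Proof.
move=> Msym; pose MC := map_mx (real_complex R) M.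
have hMC : MC \is hermsymmx.
  apply: realsym_hermsym.
    by apply/is_hermitianmxP; rewrite expr0 scale1r map_mx_id// map_trmx Msym.
  by apply/mxOverP => i j; rewrite mxE; apply/complex_realP; exists (M i j).
have /hermitian_normalmx/orthomx_spectralP eqM := hMC.
have /mxOverP/(_ 0 0)/complex_realP[a aE] := hermitian_spectral_diag_real hMC.
have unitP := spectral_unit MC.
have eigMC : eigenvalue MC (real_complex R a).
  apply/eigenvalueP; exists (row 0 (spectralmx MC)).
    rewrite -row_mul {2}eqM !mulmxA mulmxV// mul1mx.
    by rewrite row_mul row_diag_mx -scalemxAl -rowE aE.
  apply/eqP => row0; have := unitP; rewrite unitmxE (expand_det_row _ 0).
  rewrite big1 ?unitr0// => j _.
  by move/rowP/(_ j): row0; rewrite !mxE => ->; rewrite mul0r.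
move: eigMC; rewrite eigenvalue_root_char -map_char_poly fmorph_root.
rewrite -eigenvalue_root_char => /eigenvalueP[v vM v0].
exists a, v^T; split; first by rewrite trmx_eq0.
by rewrite -[M in LHS]Msym -trmx_mul vM linearZ.
Qed.

(** The reflection along [v - e] exchanges the unit vectors [e] and [v]. *)
Lemma householder n (v : 'cV[R]_n.+1) : dotv v v = 1 ->
  exists H : 'M[R]_n.+1, [/\ H^T = H, H *m H = 1%:M & H *m delta_mx 0 0 = v].
Proof.
move=> v1; pose e : 'cV[R]_n.+1 := delta_mx 0 0.
have [->|ve] := eqVneq v e.
  by exists 1%:M; rewrite trmx1 !mul1mx.
pose w := v - e.
have we : w^T *m e = (v 0 0 - 1)%:M.
  rewrite -colE [LHS]mx11_scalar; congr (_%:M).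
  by rewrite !mxE.
have vv : v^T *m v = 1%:M by rewrite [LHS]mx11_scalar -dotvE v1.
have ee : e^T *m e = 1%:M.
  by rewrite /e -colE [LHS]mx11_scalar !mxE.
have ve1 : v^T *m e = (v 0 0)%:M by rewrite /e -colE [LHS]mx11_scalar !mxE.
have ev1 : e^T *m v = (v 0 0)%:M.
  by rewrite -[LHS]trmxK trmx_mul trmxK ve1 tr_scalar_mx.
have ww : w^T *m w = (2 * (1 - v 0 0))%:M.
  have wT : w^T = v^T - e^T by rewrite linearB.
  rewrite wT /w mulmxBl !mulmxBr vv ve1 ev1 ee -!raddfB/=.
  by congr (_%:M); ring.
have w0 : 1 - v 0 0 != 0.
  apply: contra_neq ve => w0; apply/eqP; rewrite -subr_eq0 -dotv_eq0 -/w.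
  by rewrite dotvE ww w0 mulr0 mxE.
(* This is 2 / |w|^2, the coefficient of the reflection along [w], because |w|^2 = 2 (1 - v_0). *)
pose c := (1 - v 0 0)^-1.
exists (1%:M - c *: (w *m w^T)); split.
- by rewrite linearB/= trmx1 linearZ/= trmx_mul trmxK.
- have PP : w *m w^T *m (w *m w^T) = (2 * (1 - v 0 0)) *: (w *m w^T).
    by rewrite mulmxA -(mulmxA w) ww mul_mx_scalar -scalemxAl.
  rewrite mulmxBl mul1mx mulmxBr mulmx1 -scalemxAl -scalemxAr PP.
  by move: (w *m w^T) => W; apply/matrixP => i j; rewrite !mxE /c; field.
- rewrite mulmxBl mul1mx -scalemxAl -mulmxA -/e we mul_mx_scalar scalerA.
  have -> : c * (v 0 0 - 1) = -1 by rewrite /c; field.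
  by rewrite scaleN1r opprK addrC subrK.
Qed.

(** Deflation: conjugating by a reflection that carries the first basis vector to a unit eigenvector
    makes the first column a multiple of that basis vector. By symmetry the matrix is then block
    diagonal, and the induction applies to the lower block. *)
Theorem real_spectral n (M : 'M[R]_n) : M^T = M ->
  exists (Q : 'M[R]_n) (d : 'rV[R]_n),
    Q *m Q^T = 1%:M /\ M = Q *m diag_mx d *m Q^T.
Proof.
elim: n M => [|n IH] M Msym.
  by exists 1%:M, 0; split; apply/matrixP => -[].
have [a [v [v0 Mv]]] := symmetric_eigenvector Msym.
pose u := (Num.sqrt (dotv v v))^-1 *: v.
have dv : dotv v v != 0 by rewrite dotv_eq0.
have u1 : dotv u u = 1.
  by rewrite dotvZl dotvZr mulrA -expr2 exprVn sqr_sqrtr ?dotv_ge0// mulVf.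
have Mu : M *m u = a *: u by rewrite -scalemxAr Mv scalerA mulrC -scalerA.
have [H [Hsym HH He]] := householder u1.
have [B BB] : exists B : 'M[R]_(1 + n), B = H *m M *m H by eexists.
have Bsym : B^T = B by rewrite BB !trmx_mul Hsym Msym mulmxA.
have Be : B *m delta_mx 0 0 = a *: (delta_mx 0 0 : 'cV[R]_n.+1).
  by rewrite BB -!mulmxA He Mu -scalemxAr -He mulmxA HH mul1mx.
have Bcol i : B i 0 = a * (i == 0)%:R.
  by have /colP/(_ i) := Be; rewrite -colE !mxE eqxx andbT.
have [Q [d [QQ dE]]] : exists (Q : 'M[R]_n) (d : 'rV[R]_n),
    Q *m Q^T = 1%:M /\ drsubmx B = Q *m diag_mx d *m Q^T.
  by apply: IH; rewrite trmx_drsub Bsym.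
have lsh0 : lshift n (0 : 'I_1) = 0 :> 'I_(1 + n) by apply/val_inj.
have BE : B = block_mx a%:M 0 0 (drsubmx B).
  rewrite -[LHS]submxK; congr block_mx.
  - by rewrite [LHS]mx11_scalar !mxE lsh0 Bcol eqxx mulr1.
  - rewrite -[ursubmx B]trmxK trmx_ursub Bsym; apply/rowP => i.
    by rewrite !mxE lsh0 Bcol mulr0.
  - by apply/colP => i; rewrite !mxE lsh0 Bcol mulr0.
pose Qb : 'M[R]_(1 + n) := block_mx 1%:M 0 0 Q.
pose db : 'rV[R]_(1 + n) := row_mx (const_mx a) d.
have QbQ : Qb *m Qb^T = 1%:M.
  rewrite tr_block_mx mulmx_block !trmx0 trmx1.
  by rewrite !mul0mx !mulmx0 ?mul1mx ?addr0 ?add0r QQ -scalar_mx_block.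
have QbB : Qb *m diag_mx db *m Qb^T = B.
  rewrite /Qb /db diag_mx_row tr_block_mx !mulmx_block !trmx0 trmx1.
  rewrite !mul0mx !mulmx0 !mulmx1 ?mul1mx ?addr0 ?add0r -dE diag_const_mx.
  by rewrite ?mul0mx ?mulmx0 ?addr0 -BE.
exists (H *m Qb), db; split; rewrite trmx_mul Hsym !mulmxA.
  by rewrite -(mulmxA H) QbQ mulmx1.
rewrite -(mulmxA H) -(mulmxA H) QbB BB.
by rewrite !mulmxA HH mul1mx -mulmxA HH mulmx1.
Qed.

End RealSymmetric.

(** * Extreme singular values as bounds on the form |A x|^2 *)

Section SingularValues.
Context {R : realType}.

Lemma char_poly_orthogonal n (Q D : 'M[R]_n) : Q *m Q^T = 1%:M ->
  char_poly (Q *m D *m Q^T) = char_poly D.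
Proof.
move=> QQ; have QQ' : map_mx polyC Q *m map_mx polyC Q^T = 1%:M.
  by rewrite -map_mxM QQ map_mx1.
rewrite /char_poly /char_poly_mx !map_mxM.
rewrite (_ : _ - _ = map_mx polyC Q *m ('X%:M - map_mx polyC D) *m
                     map_mx polyC Q^T); last first.
  rewrite mulmxBr mulmxBl mul_mx_scalar -scalemxAl QQ'.
  by rewrite -mul_scalar_mx mulmx1.
by rewrite !det_mulmx mulrAC -det_mulmx QQ' det1 mul1r.
Qed.

Lemma dotv_orthogonal n (Q : 'M[R]_n) x : Q *m Q^T = 1%:M ->
  dotv (Q^T *m x) (Q^T *m x) = dotv x x.
Proof. by move=> QQ; rewrite dotv_mulmx trmxK mulmxA QQ mul1mx. Qed.

(** [xget] returns an element of the set once the set is inhabited; a witness is obtained by taking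
    square roots of the diagonal in a spectral decomposition. *)
Lemma sqrtmxP n (M : 'M[R]_n) : psdmx M ->
  psdmx (sqrtmx M) /\ sqrtmx M *m sqrtmx M = M.
Proof.
move=> [Msym M0]; apply: (@xgetPex _ 0 [set B | psdmx B /\ B *m B = M]).
have [Q [d [QQ ME]]] := real_spectral Msym.
have QQ' : Q^T *m Q = 1%:M by apply: mulmx1C.
(* Evaluating the form at the [i]-th column of [Q] returns the diagonal entry [d 0 i]. *)
have d0 i : 0 <= d 0 i.
  have := M0 (Q *m delta_mx i 0); rewrite ME dotv_mulmx !mulmxA QQ' mul1mx.
  rewrite -!mulmxA (mulmxA Q^T) QQ' mul1mx dotvE trmx_delta -rowE -colE.
  by rewrite !mxE eqxx mulr1n.
pose s := \row_j Num.sqrt (d 0 j).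
exists (Q *m diag_mx s *m Q^T); split; [split|].
- by rewrite !trmx_mul trmxK tr_diag_mx mulmxA.
- move=> x; rewrite -!mulmxA dotvC dotv_mulmx; apply: sumr_ge0 => i _.
  by rewrite mul_diag_mx !mxE -mulrA -expr2 mulr_ge0 ?sqr_ge0 ?sqrtr_ge0.
- rewrite ME !mulmxA -(mulmxA _ Q^T) QQ' mulmx1 -(mulmxA Q) mulmx_diag.
  congr (_ *m diag_mx _ *m _); apply/rowP => i.
  by rewrite !mxE -expr2 sqr_sqrtr.
Qed.

(** Sorting the diagonal of a spectral decomposition shows that the list exists. Its length is then
    read off the degree of the characteristic polynomial, and its members off the roots. *)
Lemma eigenvaluesP n (M : 'M[R]_n) : M^T = M ->
  exists (Q : 'M[R]_n) (d : 'rV[R]_n),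
    [/\ Q *m Q^T = 1%:M, M = Q *m diag_mx d *m Q^T, size (eigenvalues M) = n,
        sorted >=%R (eigenvalues M) & eigenvalues M =i codom (d 0)].
Proof.
move=> Msym; have [Q [d [QQ ME]]] := real_spectral Msym.
have charM : char_poly M = \prod_(a <- codom (d 0)) ('X - a%:P).
  rewrite ME char_poly_orthogonal// char_poly_trig ?diag_mx_is_trig//.
  by rewrite big_map big_enum; apply: eq_bigr => i _; rewrite mxE eqxx mulr1n.
have [srt charE] : sorted >=%R (eigenvalues M) /\
    char_poly M = \prod_(a <- eigenvalues M) ('X - a%:P).
  apply: (@xgetPex _ [::] [set s | sorted >=%R s /\ _ = \prod_(a <- s) _]).
  exists (sort >=%R (codom (d 0))); split.
    by apply: sort_sorted => x y; rewrite le_total.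
  by rewrite charM; apply: perm_big; rewrite perm_sym perm_sort.
exists Q, d; split => //.
  by apply: succn_inj; rewrite -(size_char_poly M) charE size_prod_XsubC.
by move=> x; rewrite -!root_prod_XsubC -charE charM.
Qed.

Context {N n : nat} (A : 'M[R]_(N, n)).
Hypothesis n0 : (0 < n)%N.

Lemma gram_psd : psdmx (A^T *m A).
Proof.
split=> [|x]; first by rewrite trmx_mul trmxK.
by rewrite -mulmxA -[A in A *m x]trmxK -dotv_mulmx trmxK dotv_ge0.
Qed.

(** With [B] the square root of [A^T *m A], |A x|^2 = |B x|^2, which is diagonal in the coordinates
    [Q^T *m x]. *)
Lemma singular_valuesP : exists (Q : 'M[R]_n) (d : 'rV[R]_n),
  [/\ Q *m Q^T = 1%:M,
      forall x, dotv (A *m x) (A *m x) =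
        \sum_i d 0 i ^+ 2 * (Q^T *m x) i 0 ^+ 2,
      forall i, 0 <= d 0 i &
      [/\ forall i, s_min A <= d 0 i <= s_max A,
      s_min A \in codom (d 0) & s_max A \in codom (d 0)]].
Proof.
have [[Bsym B0] BB] := sqrtmxP gram_psd.
have [Q [d [QQ BE sz srt mem]]] := eigenvaluesP Bsym.
have QQ' : Q^T *m Q = 1%:M by apply: mulmx1C.
exists Q, d; split => //.
- move=> x; rewrite dotv_mulmx mulmxA -BB -mulmxA.
  rewrite -[X in dotv x (X *m _)]Bsym -dotv_mulmx BE -!mulmxA dotv_mulmx.
  rewrite (mulmxA Q^T) QQ' mul1mx; apply: eq_bigr => i _.
  by rewrite mul_diag_mx !mxE mulrACA -!expr2.
- move=> i; have := B0 (Q *m delta_mx i 0); rewrite BE dotv_mulmx !mulmxA QQ' mul1mx.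
  rewrite -!mulmxA (mulmxA Q^T) QQ' mul1mx dotvE trmx_delta -rowE -colE.
  by rewrite !mxE eqxx mulr1n.
have szS : size (singular_values A) = n by [].
have ge_tr : transitive (>=%R : rel R) by move=> x y z /[swap]; apply: le_trans.
split=> [i||]; rewrite -?mem ?mem_nth ?szS ?ltn_predL//.
have : d 0 i \in singular_values A by rewrite mem codom_f.
move=> /(nthP 0)[k]; rewrite szS => kn <-.
have mono := sorted_leq_nth ge_tr (@lexx _ R) 0 srt.
apply/andP; split; apply: mono; rewrite ?inE ?sz ?ltn_predL//.
by rewrite -ltnS prednK.
Qed.

Lemma s_min_ge0 : 0 <= s_min A.
Proof. by have [Q [d [_ _ d0 [_ /codomP[i ->] _]]]] := singular_valuesP. Qed.

Lemma s_min_le_s_max : s_min A <= s_max A.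
Proof.
have [Q [d [_ _ _ [le_d _ _]]]] := singular_valuesP.
by have /andP[/le_trans] := le_d (Ordinal n0); apply.
Qed.

(** Left to right, each weight in the diagonal form is at most [b ^+ 2]; right to left, the form is
    tested on the column of [Q] whose weight is [s_max A]. *)
Lemma s_max_leP b : 0 <= b ->
  s_max A <= b <-> forall x, dotv (A *m x) (A *m x) <= b ^+ 2 * dotv x x.
Proof.
move=> b0; have [Q [d [QQ dA d0 [le_d _ /codomP[k kE]]]]] := singular_valuesP.
split=> [sb x|/(_ (Q *m delta_mx k 0))].
  rewrite dA -(dotv_orthogonal x QQ) mulr_sumr; apply: ler_sum => i _.
  rewrite -expr2 ler_wpM2r ?sqr_ge0// ler_sqr ?nnegrE//.
  by have /andP[_ /le_trans] := le_d i; apply.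
rewrite dA dotv_mulmx mulmxA (mulmx1C QQ) mul1mx.
rewrite (bigD1 k)//= big1 => [|i ik]; last by rewrite !mxE (negPf ik) expr0n mulr0.
rewrite !dotvE trmx_delta mul_delta_mx !mxE !eqxx expr1n !mulr1 addr0.
by rewrite ler_sqr ?nnegrE// -kE.
Qed.

Lemma s_min_geP a : 0 <= a ->
  a <= s_min A <-> forall x, a ^+ 2 * dotv x x <= dotv (A *m x) (A *m x).
Proof.
move=> a0; have [Q [d [QQ dA d0 [le_d /codomP[k kE] _]]]] := singular_valuesP.
split=> [sa x|/(_ (Q *m delta_mx k 0))].
  rewrite dA -(dotv_orthogonal x QQ) mulr_sumr; apply: ler_sum => i _.
  rewrite -expr2 ler_wpM2r ?sqr_ge0// ler_sqr ?nnegrE//.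
  by have /andP[+ _] := le_d i; apply: le_trans.
rewrite dA dotv_mulmx mulmxA (mulmx1C QQ) mul1mx.
rewrite (bigD1 k)//= big1 => [|i ik]; last by rewrite !mxE (negPf ik) expr0n mulr0.
rewrite !dotvE trmx_delta mul_delta_mx !mxE !eqxx expr1n !mulr1 addr0.
by rewrite ler_sqr ?nnegrE// -kE.
Qed.

End SingularValues.

(** * Decoupling and nets *)

Section Decoupling.

(** Such sets are [j] added to a subset of the complement of [{j, k}], so there are 2^(n-2) of
    them. *)
Lemma card_separating n (j k : 'I_n) : j != k ->
  (4 * #|[set T : {set 'I_n} | (j \in T) && (k \notin T)]%SET| = 2 ^ n)%N.
Proof.
move=> jk; have -> : [set T : {set 'I_n} | (j \in T) && (k \notin T)]%SET =
    [set j |: S | S : {set 'I_n} in powerset (~: [set j; k])]%SET.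
  apply/setP => T; rewrite inE; apply/andP/imsetP => [[jT kT]|[S + ->]].
    exists (T :\ j)%SET; last by rewrite finset.setD1K.
    rewrite powersetE; apply/fintype.subsetP => i; rewrite !inE negb_or.
    by case/andP => -> iT; apply: contraNneq kT => <-.
  rewrite powersetE => /fintype.subsetP SC; rewrite !inE eqxx/= negb_or eq_sym jk.
  by split=> //; apply/negP => /SC; rewrite !inE eqxx orbT.
rewrite card_in_imset => [|S S']; last first.
  rewrite !powersetE => /fintype.subsetP SC /fintype.subsetP SC' /setP E.
  apply/setP => i; have := E i; rewrite !inE; have [->|//] := eqVneq i j.
  by move=> _; apply/idP/idP => [/SC|/SC']; rewrite !inE eqxx.
rewrite card_powerset; have := cardsC [set j; k]%SET; rewrite cards2 jk card_ord.
by move=> nE; rewrite -[in RHS]nE expnD.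
Qed.

(** Averaging over all [T]: each ordered pair of distinct indices is separated by exactly a quarter
    of the sets, so the off-diagonal sum is four times the mean of the decoupled sums. *)
Lemma decoupling (R : realFieldType) n (a : 'I_n -> 'I_n -> R) (b : R) :
  (forall T : {set 'I_n}, `|\sum_(j in T) \sum_(k in ~: T) a j k| <= b) ->
  `|\sum_j \sum_(k | k != j) a j k| <= 4 * b.
Proof.
move=> ab; set s := \sum_j _.
have sE : (2 ^ n)%:R * s =
    4 * \sum_(T : {set 'I_n}) \sum_(j in T) \sum_(k in ~: T) a j k.
  transitivity (4 * \sum_j \sum_k a j k *+
      #|[set T : {set 'I_n} | (j \in T) && (k \notin T)]%SET|).
    rewrite /s !mulr_sumr; apply: eq_bigr => j _; rewrite mulr_sumr.
    rewrite [RHS]mulr_sumr [RHS](bigD1 j)//=.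
    rewrite (_ : [set T | _]%SET = finset.set0); last first.
      by apply/setP => T; rewrite !inE andbN.
    rewrite cards0 mulr0n mulr0 add0r; apply: eq_bigr => k kj.
    rewrite -(@card_separating n j k) 1?eq_sym// natrM -mulrA; congr (_ * _).
    by rewrite mulr_natl.
  congr (_ * _); under [RHS]eq_bigr do rewrite big_mkcond/=.
  rewrite [RHS]exchange_big/=; apply: eq_bigr => j _.
  rewrite -big_mkcond/=; under [RHS]eq_bigr do rewrite big_mkcond/=.
  rewrite [RHS]exchange_big/=; apply: eq_bigr => k _; rewrite -big_mkcondr/= -sumr_const.
  by apply: eq_bigl => T; rewrite !inE.
have n0 : 0 < (2 ^ n)%:R :> R by rewrite ltr0n expn_gt0.
rewrite -(ler_pM2l n0) (_ : _ * `|s| = `|(2 ^ n)%:R * s|); last first.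
  by rewrite normrM (gtr0_norm n0).
rewrite sE.
rewrite normrM (@ger0_norm _ 4)// mulrCA ler_pM2l//.
rewrite (le_trans (ler_norm_sum _ _ _))// (le_trans (ler_sum _ (fun T _ => ab T)))//.
by rewrite sumr_const -cardsT -powersetT card_powerset cardsT card_ord mulr_natl.
Qed.

End Decoupling.

(** * A net of the Euclidean unit ball *)

Section Net.
Context {R : realType}.

(* Integer coordinates are stored as a sign and an absolute value. *)
Definition grid n := {ffun 'I_n -> bool * 'I_(64 * n).+1}.

(** The mesh 1 / (8 sqrt n) makes coordinatewise rounding cost at most n / (64 n) = 1/64 in squared
    norm. *)
Definition grid_vec n (g : grid n) : 'cV[R]_n :=
  \col_i ((-1) ^+ (g i).1 * (g i).2%:R / (8 * Num.sqrt n%:R)).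

(* An integer vector with sum of squares at most [64 n] has sum of absolute
   values at most [64 n]; the latter condition is the one that is easy to count
   with a product generating function. *)
Definition net n := [set g : grid n | (\sum_i (g i).2 <= 64 * n)%N]%SET.

(** Each coordinate is rounded towards 0, so the norm does not grow and the error per coordinate is
    at most the mesh. *)
Lemma grid_vec_approx n (x : 'cV[R]_n) : dotv x x <= 1 ->
  exists2 g : grid n, g \in net n &
    dotv (grid_vec g) (grid_vec g) <= 1 /\
    dotv (x - grid_vec g) (x - grid_vec g) <= 64^-1.
Proof.
case: n x => [|n] x x1.
  exists [ffun i => (false, ord0)]; first by rewrite inE big_ord0.
  by rewrite /dotv !big_ord0 ler01 invr_ge0.
set m := n.+1; set h : R := 8 * Num.sqrt m%:R.
have h0 : 0 < h by rewrite mulr_gt0// sqrtr_gt0 ltr0n.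
have h2 : h ^+ 2 = 64 * m%:R by rewrite exprMn sqr_sqrtr ?ler0n// -natrX.
pose t i := Num.trunc (h * `|x i 0|).
have tP i : (t i)%:R <= h * `|x i 0| < (t i)%:R + 1.
  by rewrite natr1 trunc_itv// mulr_ge0// ltW.
have tsum : (\sum_i t i ^ 2 <= 64 * m)%N.
  rewrite -(ler_nat R) natr_sum natrM -h2 -[leRHS]mulr1.
  rewrite (le_trans _ (ler_wpM2l _ x1)) ?sqr_ge0// mulr_sumr; apply: ler_sum => i _.
  have /andP[ti _] := tP i; rewrite natrX -expr2 -[x i 0 ^+ 2]real_normK ?num_real//.
  by rewrite -exprMn ler_sqr ?nnegrE// mulr_ge0// ltW.
(* A natural number is at most its square, so the bound on the sum of squares passes to the plain
   sum. *)
have tsum1 : (\sum_i t i <= 64 * m)%N.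
  apply: leq_trans tsum; apply: leq_sum => i _.
  by case: (t i) => // k; rewrite leq_pmulr.
have tm i : (t i < (64 * m).+1)%N.
  by rewrite ltnS (leq_trans _ tsum1)// (bigD1 i)//= leq_addr.
exists [ffun i => (x i 0 < 0, Ordinal (tm i))].
  by rewrite inE; under eq_bigr do rewrite ffunE.
have xs i : x i 0 = (-1) ^+ (x i 0 < 0)%R * `|x i 0|.
  by rewrite -numEsign.
split.
  rewrite (le_trans _ x1)//; apply: ler_sum => i _.
  rewrite !mxE ffunE/= -/h -!expr2 [leRHS](_ : _ = `|x i 0| ^+ 2); last first.
    by rewrite real_normK ?num_real.
  rewrite !exprMn sqrr_sign mul1r -exprMn ler_sqr ?nnegrE ?divr_ge0 ?ler0n ?(ltW h0)//.
  by rewrite ler_pdivrMr// mulrC; have /andP[] := tP i.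
apply: (@le_trans _ _ (\sum_(i < m) (h ^- 2))).
  apply: ler_sum => i _; rewrite !mxE ffunE/= -/h -expr2 {1}xs -mulrA -mulrBr.
  rewrite exprMn sqrr_sign mul1r -exprVn ler_sqr ?nnegrE ?invr_ge0 ?(ltW h0)//.
    rewrite lerBlDl -[X in _ + X]mul1r -mulrDl ler_pdivlMr// mulrC.
    by have /andP[_ /ltW] := tP i.
  by rewrite subr_ge0 ler_pdivrMr// mulrC; have /andP[] := tP i.
rewrite sumr_const card_ord -[leLHS]mulr_natr h2 invfM -mulrA mulVf ?mulr1// pnatr_eq0.
by [].
Qed.

(** On the net, 2^(64 n) times the product of the 2^(- |g_i|) is at least 1. Summed over the whole
    grid this product factors over coordinates, and each factor is at most 4: two signs, times a
    geometric sum at most 2. *)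
Lemma card_net n : (#|net n|)%:R <= 2 ^+ (66 * n) :> R.
Proof.
have geom M : \sum_(k < M) (2^-1 : R) ^+ k <= 2.
  have : \sum_(k < M) (2^-1 : R) ^+ k = 2 - 2 * 2^-1 ^+ M.
    elim: M => [|M IH]; first by rewrite big_ord0 expr0 mulr1 subrr.
    by rewrite big_ord_recr/= IH exprS; field.
  by move=> ->; rewrite gerBl mulr_ge0// exprn_ge0.
rewrite -sumr_const.
apply: (@le_trans _ _
    (\sum_(g : grid n) 2 ^+ (64 * n) * \prod_i (2^-1 : R) ^+ (g i).2)).
  rewrite [leRHS](bigID (mem (net n)))/= -[leLHS]addr0 lerD//.
    apply: ler_sum => g; rewrite inE => gn.
    rewrite prodrXr exprVn ler_pdivlMr ?exprn_gt0// mul1r.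
    by rewrite ler_weXn2l// ler1n.
  by apply: sumr_ge0 => g _; rewrite mulr_ge0 ?exprn_ge0// prodr_ge0// => i _;
    rewrite exprn_ge0.
rewrite -mulr_sumr -(bigA_distr_bigA (fun _ p => 2^-1 ^+ (nat_of_ord p.2)))/=.
have E66 : (66 * n = 64 * n + 2 * n)%N by rewrite -mulnDl.
rewrite prodr_const card_ord E66 exprD ler_pM2l ?exprn_gt0//.
rewrite exprM; apply: lerXn2r; rewrite ?nnegrE ?exprn_ge0//.
  by apply: sumr_ge0 => i _; rewrite exprn_ge0.
rewrite -(pair_bigA _ (fun _ (k : 'I_(64 * n).+1) => 2^-1 ^+ k))/=.
rewrite big_bool/= expr2 -[2 * 2]/((1 + 1) * 2) mulrDl !mul1r.
by apply: lerD; exact: geom.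
Qed.

End Net.

(** * The deterministic estimate *)

Section Deterministic.
Context {R : realType} {N n : nat}.
Implicit Types (A : 'M[R]_(N, n)) (x : 'cV[R]_n) (T : {set 'I_n}).

Definition restr_vec T x : 'cV[R]_n := \col_i (if i \in T then x i 0 else 0).

(** Outside this event, Cauchy-Schwarz controls the decoupled sum for [T]. The vector [z] involves
    only the columns outside [T], and only its direction matters. *)
Definition decoupled_bad (u : R) T x A : bool :=
  let z := A *m restr_vec (~: T)%SET x in
  u ^+ 2 * dotv z z < \sum_(j in T) dotv (col j A) z ^+ 2.

Lemma dotvBl k (x y z : 'cV[R]_k) : dotv (x - y) z = dotv x z - dotv y z.
Proof. by rewrite -scaleN1r dotvDl dotvZl mulN1r. Qed.

Lemma dotvBr k (x y z : 'cV[R]_k) : dotv z (x - y) = dotv z x - dotv z y.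
Proof. by rewrite !(dotvC z) dotvBl. Qed.

Lemma dotvD_sqr k (x y : 'cV[R]_k) :
  dotv (x + y) (x + y) + dotv (x - y) (x - y) = 2 * dotv x x + 2 * dotv y y.
Proof. by rewrite !(dotvBl, dotvBr, dotvDl, dotvDr) (dotvC y x); ring. Qed.

Definition deviation A x : R := dotv (A *m x) (A *m x) - N%:R * dotv x x.

Lemma deviationZ A a x : deviation A (a *: x) = a ^+ 2 * deviation A x.
Proof. by rewrite /deviation -scalemxAr !dotvZl !dotvZr; ring. Qed.

(** Polarization of the quadratic form along [x - y] and [x + y]. The weights 4 and 1/4 balance |x -
    y| <= 1/8 against |x + y| <= 2, bringing both vectors to length at most 1/2. *)
Lemma deviationB A x y :
  deviation A x - deviation A y =
  4^-1 * (deviation A (4 *: (x - y) + 4^-1 *: (x + y)) -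
          deviation A (4 *: (x - y) - 4^-1 *: (x + y))).
Proof.
rewrite /deviation !(mulmxBr, mulmxDr) -!scalemxAr !(mulmxBr, mulmxDr).
rewrite !(dotvBl, dotvBr, dotvDl, dotvDr, dotvZl, dotvZr).
by rewrite (dotvC (A *m y) (A *m x)) (dotvC y x); field.
Qed.

Lemma gram_sum A x :
  dotv (A *m x) (A *m x) =
  \sum_j \sum_k x j 0 * x k 0 * dotv (col j A) (col k A).
Proof.
transitivity (\sum_i \sum_j \sum_k x j 0 * x k 0 * (A i j * A i k)).
  apply: eq_bigr => i _; rewrite mxE big_distrlr/=; apply: eq_bigr => j _.
  by apply: eq_bigr => k _; ring.
rewrite exchange_big; apply: eq_bigr => j _.
rewrite exchange_big; apply: eq_bigr => k _.
by rewrite -mulr_sumr; congr (_ * _); apply: eq_bigr => i _; rewrite !mxE.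
Qed.

Lemma cauchy_schwarz_sum (I : finType) (P : pred I) (a b : I -> R) :
  (\sum_(i | P i) a i * b i) ^+ 2 <=
  (\sum_(i | P i) a i ^+ 2) * (\sum_(i | P i) b i ^+ 2).
Proof.
set sa := \sum_(i | P i) a i ^+ 2; set sb := \sum_(i | P i) b i ^+ 2.
set c := \sum_(i | P i) _.
have quad t : 0 <= sa - 2 * t * c + t ^+ 2 * sb.
  rewrite /sa /sb /c !mulr_sumr -sumrB -big_split/=; apply: sumr_ge0 => i _.
  by rewrite [leRHS](_ : _ = (a i - t * b i) ^+ 2) ?sqr_ge0//; ring.
have sb0 : 0 <= sb by apply: sumr_ge0 => i _; exact: sqr_ge0.
have [sbp|] := ltP 0 sb.
  have := quad (c / sb); rewrite -(pmulr_lge0 _ sbp) => h.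
  rewrite -subr_ge0; apply: le_trans h _; rewrite [leLHS](_ : _ = sa * sb - c ^+ 2)//.
  by field; rewrite gt_eqF.
move=> sbn; have sbE : sb = 0 by apply/eqP; rewrite eq_le sbn sb0.
rewrite sbE mulr0; have [->|c0] := eqVneq c 0; first by rewrite expr0n.
(* With [sb = 0] the quadratic is affine in its argument; this value would make it -1. *)
have := quad ((sa + 1) / (2 * c)); rewrite sbE mulr0 addr0.
have -> : 2 * ((sa + 1) / (2 * c)) * c = sa + 1 by field.
by rewrite opprD addNKr oppr_ge0 ler10.
Qed.

(** * Bootstrap of the deviation on the good event *)

Section Bounds.
Variables (A : 'M[R]_(N, n)) (u : R).
Hypothesis u0 : 0 <= u.
Hypothesis colA : forall j, dotv (col j A) (col j A) = N%:R.
Hypothesis good : forall g : grid n, g \in net n -> forall T,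
  ~~ decoupled_bad u T (grid_vec g) A.

(** The best constant is the supremum over the unit ball, finite since all coordinates there are at
    most 1 in absolute value. Its minimality lets [q] be bounded later in terms of itself. *)
Lemma deviation_sup : exists2 q, 0 <= q &
  (forall x, `|deviation A x| <= q * dotv x x) /\
  (forall r, (forall x, dotv x x <= 1 -> `|deviation A x| <= r) -> q <= r).
Proof.
pose S := [set `|deviation A x| | x in [set x | dotv x x <= 1]].
have S0 : S 0.
  exists 0; first by rewrite /= -(scale0r 0) dotvZl mul0r ler01.
  by rewrite -(scale0r 0) deviationZ expr0n mul0r normr0.
have supS : has_sup S.
  split; first by exists 0.
  exists (\sum_j \sum_k `|dotv (col j A) (col k A)| + N%:R) => _ [x /= x1 <-].
  have xi j : `|x j 0| <= 1.
    rewrite -(@ler_pXn2r _ 2)// ?nnegrE// expr1n real_normK ?num_real//.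
    apply: le_trans x1; rewrite /dotv (bigD1 j)//= -expr2 lerDl.
    by apply: sumr_ge0 => i _; rewrite -expr2 sqr_ge0.
  rewrite (le_trans (ler_normB _ _))// lerD//.
    rewrite gram_sum (le_trans (ler_norm_sum _ _ _))// ler_sum// => j _.
    rewrite (le_trans (ler_norm_sum _ _ _))// ler_sum// => k _.
    by rewrite !normrM ler_piMl// mulr_ile1.
  by rewrite normrM normr_nat ger0_norm ?dotv_ge0// ler_piMr.
have ubS x : dotv x x <= 1 -> `|deviation A x| <= sup S.
  by move=> x1; apply: sup_upper_bound => //; exists x.
have q0 : 0 <= sup S by apply: sup_upper_bound.
exists (sup S) => //; split=> [x|r rS]; last first.
  by apply: ge_sup; [exists 0|move=> _ [x x1 <-]; exact: rS].
have [->|x0] := eqVneq x 0.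
  by rewrite -(scale0r 0) deviationZ expr0n mul0r normr0 mulr_ge0 ?dotv_ge0.
have dx : 0 < dotv x x by rewrite lt_def dotv_eq0 x0 dotv_ge0.
set l := Num.sqrt (dotv x x); have l0 : 0 < l by rewrite sqrtr_gt0.
have l2 : l ^+ 2 = dotv x x by rewrite sqr_sqrtr ?dotv_ge0.
set e := l^-1 *: x; have e1 : dotv e e = 1.
  by rewrite dotvZl dotvZr mulrA -expr2 exprVn l2 mulVf// gt_eqF.
have -> : x = l *: e by rewrite scalerA divff ?gt_eqF// scale1r.
rewrite deviationZ normrM [X in X * _]ger0_norm ?sqr_ge0// mulrC.
by rewrite dotvZl dotvZr mulrA -expr2 e1 mulr1 ler_wpM2r ?sqr_ge0// ubS ?e1.
Qed.

(** The diagonal terms cancel against [N%:R * dotv y y] since all columns have squared norm [N];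
    each decoupled sum is then bounded by Cauchy-Schwarz and the good event. *)
Lemma deviation_net q g : 0 <= q ->
  (forall x, `|deviation A x| <= q * dotv x x) ->
  g \in net n -> dotv (grid_vec g) (grid_vec g) <= 1 :> R ->
  `|deviation A (grid_vec g)| <= 4 * (u * Num.sqrt (N%:R + q)).
Proof.
move=> q0 Aq gn; set y := grid_vec g => y1.
have -> : deviation A y =
    \sum_j \sum_(k | k != j) y j 0 * y k 0 * dotv (col j A) (col k A).
  rewrite /deviation gram_sum mulr_sumr -sumrB; apply: eq_bigr => j _.
  by rewrite (bigD1 j)//= colA mulrC addrAC subrr add0r.
apply: decoupling => T; set z := A *m restr_vec (~: T)%SET y.
have zE j : \sum_(k in ~: T) y j 0 * y k 0 * dotv (col j A) (col k A) =
    y j 0 * dotv (col j A) z.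
  rewrite big_mkcond mulr_sumr /=.
  transitivity (\sum_k \sum_i y j 0 *
      (A i j * (A i k * (if k \in ~: T then y k 0 else 0)))).
    apply: eq_bigr => k _; case: ifP => kT.
      by rewrite mulr_sumr; apply: eq_bigr => i _; rewrite !mxE; ring.
    by rewrite big1// => i _; rewrite !mulr0.
  rewrite exchange_big; apply: eq_bigr => i _.
  rewrite -!mulr_sumr !mxE; do 2!congr (_ * _); apply: eq_bigr => k _.
  by rewrite [in RHS]mxE.
under eq_bigr do rewrite zE.
(* A restriction of [y] stays in the unit ball, so the global constant [q] bounds |z| as well. *)
have zq : dotv z z <= N%:R + q.
  rewrite /z; set v := restr_vec _ y; have v1 : dotv v v <= 1.
    apply: le_trans y1; apply: ler_sum => i _; rewrite mxE; case: ifP => // _.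
    by rewrite mulr0 -expr2 sqr_ge0.
  have /ler_normlP[_] := Aq v; rewrite lerBlDl => /le_trans; apply.
  by rewrite -mulrDl ler_piMr// addr_ge0.
rewrite -(@ler_pXn2r _ 2)// ?nnegrE// ?mulr_ge0 ?sqrtr_ge0// real_normK ?num_real//.
rewrite (le_trans (cauchy_schwarz_sum _ _ _))// exprMn sqr_sqrtr ?addr_ge0//.
have := good gn T; rewrite /decoupled_bad -/y -/z -leNgt => gT.
rewrite -[leRHS]mul1r; apply: ler_pM.
- by apply: sumr_ge0 => i _; exact: sqr_ge0.
- by apply: sumr_ge0 => i _; exact: sqr_ge0.
- apply: le_trans y1; rewrite /dotv [leRHS](bigID (mem T))/= -[leLHS]addr0 lerD//.
  by apply: sumr_ge0 => i _; rewrite -expr2 sqr_ge0.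
- by rewrite (le_trans gT)// ler_wpM2l ?sqr_ge0.
Qed.

(** Passing from the net to the ball costs at most [q / 2], which is absorbed: [q <= 8 * u * s] with
    [s ^+ 2 = N%:R + q], a quadratic inequality in [s]. *)
Lemma deviation_bound :
  exists2 q, 0 <= q /\ q <= 8 * u * (Num.sqrt N%:R + 8 * u) &
    forall x, `|deviation A x| <= q * dotv x x.
Proof.
have [q q0 [Aq qmin]] := deviation_sup; exists q => //; split=> //.
set s := Num.sqrt (N%:R + q); set r := Num.sqrt N%:R.
have s0 : 0 <= s by rewrite sqrtr_ge0.
have r0 : 0 <= r by rewrite sqrtr_ge0.
have s2 : s ^+ 2 = N%:R + q by rewrite sqr_sqrtr// addr_ge0.
have r2 : r ^+ 2 = N%:R by rewrite sqr_sqrtr.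
have un0 := u0.
suff qs : q <= 4 * (u * s) + q / 2.
  have qu : q <= 8 * u * s by lra.
  apply: (le_trans qu); rewrite ler_wpM2l// ?mulr_ge0//.
  suff : s - 4 * u <= r + 4 * u by lra.
  have [su|su] := leP (s - 4 * u) 0; first by lra.
  have ru0 : 0 <= r * u by rewrite mulr_ge0.
  (* Completing the square in [s ^+ 2 - 8 * u * s <= r ^+ 2]. *)
  have sqr : (s - 4 * u) ^+ 2 <= (r + 4 * u) ^+ 2.
    by rewrite !expr2 in s2 r2 *; lra.
  have rp : 0 <= r + 4 * u by lra.
  by move: sqr; rewrite ler_sqr ?nnegrE ?(ltW su).
apply: qmin => x x1; have [g gn [y1 xy]] := grid_vec_approx x1.
move: y1 xy (deviation_net q0 Aq gn); set y := grid_vec g => y1 xy /(_ y1) Ay.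
rewrite -[deviation A x](subrK (deviation A y)) addrC (le_trans (ler_normD _ _))//.
rewrite lerD// deviationB; set a := 4 *: _; set b := 4^-1 *: _.
have a1 : dotv a a <= 4^-1 by rewrite dotvZl dotvZr; lra.
have b1 : dotv b b <= 4^-1.
  rewrite dotvZl dotvZr; have := dotvD_sqr x y; have := dotv_ge0 (x - y); lra.
rewrite normrM ger0_norm ?invr_ge0//.
have ab := ler_normB (deviation A (a + b)) (deviation A (a - b)).
have := dotvD_sqr a b; have := Aq (a + b); have := Aq (a - b).
move: (dotv (a + b) _) (dotv (a - b) _) => d1 d2 h1 h2 d12.
have : q * (d1 + d2) <= q * 1 by rewrite ler_wpM2l// d12; lra.
by lra.
Qed.

Lemma gram_upper x :
  dotv (A *m x) (A *m x) <= (Num.sqrt N%:R + 8 * u) ^+ 2 * dotv x x.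
Proof.
have un0 := u0; have [q [q0 qu] Aq] := deviation_bound.
set r := Num.sqrt N%:R in qu *.
have r0 : 0 <= r by rewrite sqrtr_ge0.
have r2 : r ^+ 2 = N%:R by rewrite sqr_sqrtr.
have /ler_normlP[_] := Aq x; rewrite lerBlDl -mulrDl => /le_trans; apply.
have ru0 : 0 <= r * u by rewrite mulr_ge0.
by rewrite ler_wpM2r ?dotv_ge0// -r2; rewrite !expr2; lra.
Qed.

Lemma gram_lower x : 0 <= Num.sqrt N%:R - 72 * u ->
  (Num.sqrt N%:R - 72 * u) ^+ 2 * dotv x x <= dotv (A *m x) (A *m x).
Proof.
have un0 := u0; have [q [q0 qu] Aq] := deviation_bound.
set r := Num.sqrt N%:R in qu * => ru.
have r2 : r ^+ 2 = N%:R by rewrite sqr_sqrtr.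
have /ler_normlP[+ _] := Aq x; rewrite opprB lerBlDr -lerBlDl -mulrBl => h.
apply: le_trans h; rewrite ler_wpM2r ?dotv_ge0// -r2.
(* As [r >= 72 * u >= u], [q] is at most 8 u r + 64 u^2 <= 72 u r, and r (r - 72 u) >= (r - 72
   u)^2. *)
by nra.
Qed.

End Bounds.

End Deterministic.

(** * Splicing independent columns *)

Section RandomMatrix.
Context {R : realType} {N n : nat}.

Lemma borelv_coord (i : 'I_N) (Y : set R) : measurable Y ->
  borelv [set x : 'cV[R]_N | Y (x i 0)].
Proof.
move=> mY; apply: sub_sigma_algebra; rewrite -bigcup_seq; exists i => /=.
  exact: mem_index_enum.
by exists Y => //; rewrite setTI.
Qed.

Lemma borelvT : borelv [set: 'cV[R]_N].
Proof.
pose G := \big[setU/set0]_(i < N) preimage_set_system setT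
  (fun x : 'cV[R]_N => x i 0) measurable.
exact: (@measurableT _ (g_sigma_algebraType G)).
Qed.

Lemma borelvI (B B' : set 'cV[R]_N) : borelv B -> borelv B' -> borelv (B `&` B').
Proof.
pose G := \big[setU/set0]_(i < N) preimage_set_system setT
  (fun x : 'cV[R]_N => x i 0) measurable.
by move=> bB bB'; apply: (@measurableI _ (g_sigma_algebraType G)).
Qed.

Lemma measurable_preimage_borelv d (T : measurableType d) (X : T -> 'cV[R]_N)
    (B : set 'cV[R]_N) : (forall i, measurable_fun setT (fun w => X w i 0)) ->
  borelv B -> measurable (X @^-1` B).
Proof.
move=> mX; apply: (@smallest_sub _ _ _ [set B | measurable (X @^-1` B)]).
  split => /=; first by rewrite preimage_set0.
    by move=> C mC; rewrite setTD preimage_setC; exact: measurableC.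
  by move=> F mF; rewrite preimage_bigcup; exact: bigcupT_measurable.
rewrite -bigcup_seq => _ [i _ [Y mY <-]] /=.
by rewrite setTI -[X in measurable X]setTI; exact: mX.
Qed.

(* A pi-system, so that a law on [mtx] is determined by its values there. *)
Definition rects : set (set (matrix R N n)) :=
  [set X | exists2 B : 'I_n -> set 'cV[R]_N, (forall j, borelv (B j)) &
     X = [set M | forall j, B j (col j M)]].

Definition mtx : measurableType rects.-sigma := g_sigma_algebraType rects.

Lemma rects_setI : setI_closed rects.
Proof.
move=> _ _ [B bB ->] [B' bB' ->]; exists (fun j => B j `&` B' j).
  by move=> j; exact: borelvI.
apply/seteqP; split=> M /=; first by move=> [h h'] j; split.
by move=> h; split=> j; have [] := h j.
Qed.

Lemma measurable_coord (i : 'I_N) (j : 'I_n) :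
  measurable_fun setT (fun M : mtx => M i j).
Proof.
move=> _ Y mY; rewrite setTI; apply: sub_sigma_algebra.
exists (fun k => if k == j then [set x | Y (x i 0)] else setT).
  by move=> k; case: ifP => _; [exact: borelv_coord|exact: borelvT].
apply/seteqP; split=> M /=.
  by move=> YM k; case: ifP => //= /eqP ->; rewrite mxE.
by move=> /(_ j); rewrite eqxx /= mxE.
Qed.

Lemma random_matrix_measurable d (T : measurableType d) (A : T -> mtx) :
  random_matrix A -> measurable_fun setT A.
Proof.
move=> mA; apply: (@measurability _ _ T mtx setT A rects) => // _ [_ [B bB ->] <-].
rewrite setTI (_ : _ @^-1` _ = \big[setI/setT]_(j < n)
    ((fun w => col j (A w)) @^-1` B j)).
  apply: bigsetI_measurable => j _; apply: measurable_preimage_borelv => // i.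
  by under eq_fun do rewrite mxE; exact: mA.
rewrite -bigcap_seq; apply/seteqP; split=> w /= h j; first by move=> _; exact: h.
by apply: h; exact: mem_index_enum.
Qed.

Definition splice (S : {set 'I_n}) (M' M : 'M[R]_(N, n)) : 'M[R]_(N, n) :=
  \matrix_(i, j) if j \in S then M' i j else M i j.

(** The two pushforward measures agree on the generating pi-system of rectangles, hence
    everywhere. *)
Lemma eq_law d1 d2 (T1 : measurableType d1) (T2 : measurableType d2)
    (P1 : {measure set T1 -> \bar R}) (P2 : {measure set T2 -> \bar R})
    (A1 : T1 -> mtx) (A2 : T2 -> mtx) :
  random_matrix A1 -> random_matrix A2 -> (P1 setT < +oo)%E ->
  (forall X, rects X -> P1 (A1 @^-1` X) = P2 (A2 @^-1` X)) ->
  forall F : mtx -> \bar R, measurable_fun setT F -> (forall M, 0 <= F M)%E ->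
  (\int[P1]_w F (A1 w) = \int[P2]_w F (A2 w))%E.
Proof.
move=> /random_matrix_measurable m1 /random_matrix_measurable m2 fin1 eq12 F mF F0.
have <- : (\int[pushforward P1 A1]_y F y = \int[P1]_w F (A1 w))%E.
  by rewrite ge0_integral_pushforward.
have <- : (\int[pushforward P2 A2]_y F y = \int[P2]_w F (A2 w))%E.
  by rewrite ge0_integral_pushforward.
apply: eq_measure_integral => X mX _.
apply: (@measure_unique _ R mtx rects (fun=> setT)) => //.
- exact: rects_setI.
- by move=> _; exists (fun=> setT) => [j|]; [exact: borelvT|apply/seteqP].
- by rewrite bigcup_const//; exists 0%N.
Qed.

Context d (T : measurableType d) (P : probability T R).
Variable A : T -> mtx.
Hypothesis mA : random_matrix A.
Hypothesis iA : independent_vectors P (fun j w => col j (A w)).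

Lemma splice_random_matrix S :
  random_matrix (fun w : T * T => splice S (A w.1) (A w.2)).
Proof.
move=> i j; under eq_fun do rewrite mxE; case: (j \in S).
  exact: (measurableT_comp (mA i j) measurable_fst).
exact: (measurableT_comp (mA i j) measurable_snd).
Qed.

(* Plays the role of conditioning on the columns outside [S]. *)
Lemma integral_splice S (F : mtx -> \bar R) : measurable_fun setT F ->
  (forall M, 0 <= F M)%E ->
  (\int[P]_w F (A w) = \int[P]_w \int[P]_w' F (splice S (A w') (A w)))%E.
Proof.
move=> mF F0.
have mS := @splice_random_matrix S.
have mFS : measurable_fun setT
    (fun w : T * T => F (splice S (A w.1) (A w.2) : mtx)).
  by apply: (measurableT_comp mF); exact: random_matrix_measurable.
(* By Tonelli it remains to see that splicing two independent copies preserves the law, which is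
   checked on rectangles. *)
transitivity (\int[P \x P]_w F (splice S (A w.1) (A w.2) : mtx))%E; last first.
  by rewrite (fubini_tonelli2 _ mFS).
apply: (eq_law mA mS) => //.
  by rewrite -ge0_fin_numE ?fin_num_measure.
move=> _ [B bB ->].
pose C j := (fun w => col j (A w)) @^-1` B j.
have mC j : measurable (C j).
  by apply: measurable_preimage_borelv => // i; under eq_fun do rewrite mxE; exact: mA.
have PC (J : {set 'I_n}) : P (\bigcap_(j in [set` J]) C j) = (\prod_(j in J) P (C j))%E.
  by apply: iA.
have mCJ (J : {set 'I_n}) : measurable (\bigcap_(j in [set` J]) C j).
  by apply: fin_bigcap_measurable.
(* For the spliced matrix a rectangle is a product event: the columns in [S] constrain the first
   copy, the others the second. *)
transitivity ((P \x P)%E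
  ((\bigcap_(j in [set` S]) C j) `*` (\bigcap_(j in [set` ~: S]%SET) C j))); last first.
  congr ((P \x P)%E _); apply/esym/seteqP; split=> [[w w'] /= h|[w w'] [/= h h'] j].
    split=> j jS; have := h j; rewrite /C /=.
      by rewrite (_ : col _ _ = col j (A w))//; apply/colP => i; rewrite !mxE jS.
    rewrite (_ : col _ _ = col j (A w'))//; apply/colP => i; rewrite !mxE.
    by move: jS; rewrite /= inE => /negPf ->.
  have [jS|jS] := boolP (j \in S).
    by have := h j jS; rewrite /C /= (_ : col _ _ = col j (splice S (A w) (A w')))//;
      apply/colP => i; rewrite !mxE jS.
  have := h' j; rewrite /= inE jS => /(_ isT).
  by rewrite /C /= (_ : col _ _ = col j (splice S (A w) (A w')))//;
      apply/colP => i; rewrite !mxE (negPf jS).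
transitivity (P (\bigcap_(j in [set` S]) C j) *
              P (\bigcap_(j in [set` ~: S]%SET) C j))%E; last first.
  by rewrite product_measure1E.
transitivity (P (\bigcap_(j in [set` [set: 'I_n]%SET]) C j)).
  congr (P _); apply/seteqP.
  by split=> w /= h j; [move=> _; exact: h|apply: h; rewrite /= inE].
rewrite !PC (bigID (mem S))/=; congr (_ * _)%E; apply: eq_bigl => j; by rewrite !inE.
Qed.

End RandomMatrix.

(** * Sub-gaussian moments *)

Section Moments.
Context {R : realType} d (T : measurableType d) (P : probability T R).
Implicit Types (Z : T -> R) (K : R).

(** The exponent [p = 2 * k] in the supremum, raised to the power [p]. *)
Lemma psi2norm_moment Z K k : (0 < k)%N -> 0 <= K ->
  (psi2norm P Z <= K%:E)%E ->
  (\int[P]_w ((Z w) ^+ (2 * k))%:E <= (K ^+ (2 * k) * (2 * k)%:R ^+ k)%:E)%E.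
Proof.
move=> k0 K0 ZK; set p : R := (2 * k)%:R.
have p1 : 1 <= p by rewrite ler1n muln_gt0.
have p0 : 0 < p by apply: lt_le_trans p1.
have NK : ('N[P]_p%:E[EFin \o Z] <= (K * p `^ 2^-1)%:E)%E.
  have : ((p `^ (- 2^-1))%:E * 'N[P]_p%:E[EFin \o Z] <= K%:E)%E.
    by apply: le_trans ZK; apply: ereal_sup_ubound; exists p.
  rewrite powRN EFinM => h.
  rewrite -(@lee_pmul2l _ (p `^ 2^-1)^-1%:E) ?lte_fin ?invr_gt0 ?powR_gt0//.
  by rewrite -[leRHS]EFinM mulrCA mulVf ?mulr1 ?gt_eqF ?powR_gt0.
have -> : (\int[P]_w ((Z w) ^+ (2 * k))%:E = 'N[P]_p%:E[EFin \o Z] `^ p)%E.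
  rewrite poweR_Lnorm ?gt_eqF//; apply: eq_integral => w _ /=.
  rewrite -[RHS]/((`|Z w| `^ p)%:E) powR_mulrn//; congr (_%:E).
  by rewrite !exprM real_normK ?num_real.
apply: (@le_trans _ _ ((K * p `^ 2^-1)%:E `^ p)%E).
  apply: (gt0_ler_poweR (ltW p0)) => //; rewrite in_itv/= leey andbT//.
    exact: Lnorm_ge0.
  by rewrite lee_fin mulr_ge0// powR_ge0.
rewrite poweR_EFin /p powR_mulrn ?mulr_ge0 ?powR_ge0// exprMn lee_fin.
by rewrite powR12_sqrt ?ler0n// [X in _ * X]exprM sqr_sqrtr.
Qed.

(** The left side is a single term of the exponential series at [k]. *)
Lemma pow_fact_le_expR k : (k%:R ^+ k / k`!%:R : R) <= expR k%:R.
Proof.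
have cvE := @is_cvg_series_exp_coeff R k%:R.
have := @nondecreasing_cvgn_le R (series (exp_coeff k%:R)) _ cvE k.+1.
rewrite /expR seriesEnat /= big_nat_recr//= {2}/exp_coeff => h.
apply: le_trans (h _).
  by rewrite lerDr sumr_ge0// => i _; exact: exp_coeff_ge0.
by apply: nondecreasing_series => i _ _; exact: exp_coeff_ge0.
Qed.

Lemma expR_nneseries (x : R) : 0 <= x ->
  (expR x)%:E = (\sum_(0 <= k <oo) (x ^+ k / k`!%:R)%:E)%E.
Proof.
move=> x0; rewrite /expR -EFin_lim; last exact: is_cvg_series_exp_coeff.
congr (limn _); apply/funext => k /=.
by rewrite seriesEnat/= sumEFin.
Qed.

(* The constant makes the exponential series dominated by a geometric one of
   ratio 1/2, since [E Z^(2k) / k! <= K^(2k) (2k)^k / k! <= (2 e K^2)^k]. *)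
Lemma psi2norm_exp_moment Z K : measurable_fun setT Z -> 0 < K ->
  (psi2norm P Z <= K%:E)%E ->
  (\int[P]_w (expR ((4 * expR 1 * K ^+ 2)^-1 * Z w ^+ 2))%:E <= 2%:E)%E.
Proof.
move=> mZ K0 ZK; set a := _^-1.
have a0 : 0 <= a by rewrite /a invr_ge0 mulr_ge0 ?sqr_ge0// mulr_ge0 ?expR_ge0.
have term0 k w : 0 <= (a * Z w ^+ 2) ^+ k / k`!%:R.
  by rewrite divr_ge0// exprn_ge0// mulr_ge0// sqr_ge0.
have az w : 0 <= a * Z w ^+ 2 by rewrite mulr_ge0 ?sqr_ge0.
under eq_integral do rewrite (expR_nneseries (az _)).
rewrite integral_nneseries//; last 2 first.
- move=> k; apply/measurable_EFinP; apply: measurable_funM => //.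
  by apply: measurable_funX; apply: measurable_funM => //; exact: measurable_funX.
- by move=> k w _; rewrite lee_fin.
have geo : (\sum_(0 <= k <oo) (geometric 1 (2^-1 : R) k)%:E = 2%:E)%E.
  have half : `|2^-1 : R| < 1 by rewrite ger0_norm ?invr_ge0// invf_lt1// ltr1n.
  have -> : 2%:E = (limn (series (geometric 1 (2^-1 : R))))%:E.
    rewrite (cvg_lim _ (cvg_geometric_series half))//; congr (_%:E); by field.
  rewrite -EFin_lim; last exact: is_cvg_geometric_series.
  by congr (limn _); apply/funext => k /=; rewrite seriesEnat/= sumEFin.
rewrite -geo; apply: lee_nneseries => k _.
  by move=> _; apply: integral_ge0 => w _; rewrite lee_fin.
have -> : (\int[P]_w ((a * Z w ^+ 2) ^+ k / k`!%:R)%:E =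
           (a ^+ k / k`!%:R)%:E * \int[P]_w (Z w ^+ (2 * k))%:E)%E.
  rewrite -ge0_integralZl//; last 3 first.
  - by apply/measurable_EFinP; exact: measurable_funX.
  - by move=> w _; rewrite lee_fin exprM exprn_ge0// sqr_ge0.
  - by rewrite lee_fin divr_ge0// exprn_ge0.
  by apply: eq_integral => w _; rewrite -EFinM exprMn exprM mulrAC.
(* The moment bound requires a positive exponent; the term of order 0 is the total mass. *)
case: k => [|k].
  rewrite /geometric/= expr0 fact0 divr1 mul1e muln0.
  under eq_integral do rewrite expr0.
  by rewrite integral_cst// mul1e mulr1; exact: probability_le1.
apply: (@le_trans _ _ ((a ^+ k.+1 / (k.+1)`!%:R)%:E *
    (K ^+ (2 * k.+1) * (2 * k.+1)%:R ^+ k.+1)%:E)%E).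
  apply: lee_wpmul2l; first by rewrite lee_fin divr_ge0// exprn_ge0.
  by apply: psi2norm_moment => //; exact: ltW.
rewrite -EFinM lee_fin /geometric/= mul1r.
have fe := @pow_fact_le_expR k.+1.
have eK : expR (k.+1)%:R = expR 1 ^+ k.+1 :> R by rewrite -expRM_natl mulr1.
rewrite eK in fe.
(* By the choice of [a], the base of this power is exactly 1/2. *)
apply: (@le_trans _ _ ((a * (2 * K ^+ 2) * expR 1) ^+ k.+1)); last first.
  rewrite le_eqVlt; apply/orP; left; apply/eqP; congr (_ ^+ _).
  by rewrite /a; field; rewrite ?gt_eqF ?expR_gt0.
rewrite [leLHS](_ : _ = (a * (2 * K ^+ 2)) ^+ k.+1 * (k.+1%:R ^+ k.+1 / (k.+1)`!%:R)).
  have aK : 0 <= a * (2 * K ^+ 2) by rewrite mulr_ge0// mulr_ge0// sqr_ge0.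
  by rewrite [leRHS]exprMn ler_wpM2l// exprn_ge0.
rewrite natrM exprM; move: (K ^+ 2) => L; rewrite !exprMn.
by move: (a ^+ _) (L ^+ _) (2 ^+ _) (k.+1%:R ^+ _) (_^-1) => x1 x2 x3 x4 x5; ring.
Qed.

End Moments.

(** * Decoupled tail bound *)

Section Chaos.
Context {R : realType} {N n : nat}.

Local Notation mtx := (@mtx R N n).

Lemma measurable_col_dotv d (T : measurableType d) (A : T -> 'M[R]_(N, n)) j
    (z : T -> 'cV[R]_N) : random_matrix A ->
  (forall i, measurable_fun setT (fun w => z w i 0)) ->
  measurable_fun setT (fun w => dotv (col j (A w)) (z w)).
Proof.
move=> mA mz; apply: measurable_sum => i; apply: measurable_funM => //.
by under eq_fun do rewrite mxE; exact: mA.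
Qed.

Lemma measurable_mulmx_dotv d (T : measurableType d) (A : T -> 'M[R]_(N, n)) x :
  random_matrix A ->
  measurable_fun setT (fun w => dotv (A w *m x) (A w *m x)).
Proof.
move=> mA; apply: measurable_sum => i.
have mi : measurable_fun setT (fun w => (A w *m x) i 0).
  under eq_fun do rewrite mxE; apply: measurable_sum => j.
  exact: measurable_funM.
exact: measurable_funM.
Qed.

Lemma mtx_random_matrix : random_matrix (id : mtx -> 'M[R]_(N, n)).
Proof. by move=> i j; exact: measurable_coord. Qed.

Lemma measurable_decoupled_bad d (T : measurableType d) (A : T -> 'M[R]_(N, n))
    u (S : {set 'I_n}) x : random_matrix A ->
  measurable [set w | decoupled_bad u S x (A w)].
Proof.
move=> mA; set y := restr_vec (~: S)%SET x.
rewrite [X in measurable X](_ : _ = (fun w =>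
    u ^+ 2 * dotv (A w *m y) (A w *m y) <
    \sum_(j in S) dotv (col j (A w)) (A w *m y) ^+ 2) @^-1` [set true])//.
rewrite -[X in measurable X]setTI; apply: measurable_fun_ltr => //.
  by apply: measurable_funM => //; exact: measurable_mulmx_dotv.
under eq_fun do rewrite big_mkcond.
apply: measurable_sum => j; case: (j \in S) => //; apply: measurable_funX.
apply: measurable_col_dotv => // i; under eq_fun do rewrite mxE.
by apply: measurable_sum => k; exact: measurable_funM.
Qed.

Context d (T : measurableType d) (P : probability T R).
Variable A : T -> mtx.
Hypothesis mA : random_matrix A.
Hypothesis iA : independent_vectors P (fun j w => col j (A w)).

(** Induction on the size of [S]: splicing separates one column from the others, so the integral
    factors and each column contributes at most 2. *)
Lemma integral_expR_sum (a : R) z (S : {set 'I_n}) : 0 <= a ->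
  (forall j, \int[P]_w (expR (a * dotv (col j (A w)) z ^+ 2))%:E <= 2%:E)%E ->
  (\int[P]_w (expR (a * \sum_(j in S) dotv (col j (A w)) z ^+ 2))%:E <=
   (2 ^+ #|S|)%:E)%E.
Proof.
move=> a0 exp1; pose F (S : {set 'I_n}) (M : mtx) : \bar R :=
  (expR (a * \sum_(j in S) dotv (col j M) z ^+ 2))%:E.
have mF S' : measurable_fun setT (F S').
  apply/measurable_EFinP; apply: (measurableT_comp (@measurable_expR R)).
  apply: measurable_funM => //; under eq_fun do rewrite big_mkcond.
  apply: measurable_sum => j; case: (j \in S') => //; apply: measurable_funX.
  by apply: measurable_col_dotv => //; exact: mtx_random_matrix.
have F0 S' M : (0 <= F S' M)%E by rewrite lee_fin expR_ge0.
have mAm := random_matrix_measurable mA.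
have mFA S' : measurable_fun setT (fun w => F S' (A w)).
  exact: (measurableT_comp (mF S')).
move: {2}#|S| (erefl #|S|) => m; elim: m S => [|m IHm] S Sm.
  rewrite Sm (cards0_eq Sm); under eq_integral do rewrite big_set0 mulr0 expR0.
  by rewrite integral_cst// mul1e; exact: probability_le1.
have [j jS'] : exists j, j \in S by apply/card_gt0P; rewrite Sm.
have jS : j \notin (S :\ j)%SET by rewrite !inE eqxx.
have IH : (\int[P]_w F (S :\ j)%SET (A w) <= (2 ^+ #|(S :\ j)%SET|)%:E)%E.
  by apply: IHm; have := cardsD1 j S; rewrite Sm jS' => -[].
(* From here on [S] is the former set with [j] removed. *)
rewrite -(finset.setD1K jS'); move: {S Sm IHm jS'}(S :\ j)%SET jS IH => S jS IH.
rewrite -[leLHS]/(\int[P]_w F (j |: S)%SET (A w))%E.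
rewrite (integral_splice mA iA S)//.
have E w w' : F (j |: S)%SET (splice S (A w') (A w)) =
    ((expR (a * dotv (col j (A w)) z ^+ 2))%:E * F S (A w'))%E.
  have colS k : k \in S -> col k (splice S (A w') (A w)) = col k (A w').
    by move=> kS; apply/colP => i; rewrite !mxE kS.
  have colj : col j (splice S (A w') (A w)) = col j (A w).
    by apply/colP => i; rewrite !mxE (negPf jS).
  rewrite /F big_setU1; last exact: jS.
  rewrite colj mulrDr expRD EFinM; congr (_ * (expR (a * _))%:E)%E.
  by apply: eq_bigr => k kS; rewrite colS.
set I := (\int[P]_w F S (A w))%E.
have I0 : (0 <= I)%E by apply: integral_ge0.
have E2 w : (\int[P]_w' F (j |: S)%SET (splice S (A w') (A w)))%E =
    ((expR (a * dotv (col j (A w)) z ^+ 2))%:E * I)%E.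
  under eq_integral do rewrite E.
  by apply: ge0_integralZl => // [w' _|]; rewrite lee_fin expR_ge0.
under eq_integral do rewrite E2.
rewrite ge0_integralZr//; last first.
- apply/measurable_EFinP; apply: (measurableT_comp (@measurable_expR R)).
  by apply: measurable_funM => //; apply: measurable_funX; exact: measurable_col_dotv.
rewrite cardsU1 jS exprS EFinM lee_pmul//.
by apply: integral_ge0 => w _; rewrite lee_fin expR_ge0.
Qed.

(** Exponential Markov inequality, after normalizing [z]. For [z = 0] both sides of the strict
    inequality vanish and the event is empty. *)
Lemma fixed_vector_tail (a u : R) (S : {set 'I_n}) (z : 'cV[R]_N) : 0 <= a ->
  (forall (j : 'I_n) (e : 'cV[R]_N), dotv e e = 1%R ->
    \int[P]_w (expR (a * dotv (col j (A w)) e ^+ 2))%:E <= 2%:E)%E ->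
  (P [set w | (u ^+ 2 * dotv z z < \sum_(j in S) dotv (col j (A w)) z ^+ 2)%R] <=
   (2 ^+ n * expR (- (a * u ^+ 2)))%:E)%E.
Proof.
move=> a0 exp1; have [->|z0] := eqVneq z 0.
  rewrite [X in P X](_ : _ = set0) ?measure0 ?lee_fin ?mulr_ge0 ?exprn_ge0 ?expR_ge0//.
  apply/seteqP; split=> // w /=; rewrite -(scale0r 0) !dotvZl mul0r mulr0.
  by rewrite big1 ?ltxx// => j _; rewrite dotvZr mul0r expr0n.
have dz : 0 < dotv z z by rewrite lt_def dotv_eq0 z0 dotv_ge0.
set l := Num.sqrt (dotv z z); have l0 : 0 < l by rewrite sqrtr_gt0.
have l2 : l ^+ 2 = dotv z z by rewrite sqr_sqrtr ?dotv_ge0.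
pose e := l^-1 *: z; have e1 : dotv e e = 1.
  by rewrite dotvZl dotvZr mulrA -expr2 exprVn l2 mulVf// gt_eqF.
have zE : z = l *: e by rewrite scalerA divff ?gt_eqF// scale1r.
have scale w : (u ^+ 2 * dotv z z < \sum_(j in S) dotv (col j (A w)) z ^+ 2) =
    (u ^+ 2 < \sum_(j in S) dotv (col j (A w)) e ^+ 2).
  have -> : \sum_(j in S) dotv (col j (A w)) z ^+ 2 =
      l ^+ 2 * \sum_(j in S) dotv (col j (A w)) e ^+ 2.
    by rewrite mulr_sumr; apply: eq_bigr => j _; rewrite -exprMn -dotvZr -zE.
  by rewrite -l2 mulrC ltr_pM2l// exprn_gt0.
rewrite [X in P X](_ : _ =
  [set w | u ^+ 2 < \sum_(j in S) dotv (col j (A w)) e ^+ 2]); last first.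
  by apply/seteqP; split=> w /=; rewrite scale.
set E := [set w | _].
pose f w := \sum_(j in S) dotv (col j (A w)) e ^+ 2.
have mf : measurable_fun setT f.
  rewrite /f; under eq_fun do rewrite big_mkcond.
  apply: measurable_sum => j; case: (j \in S) => //; apply: measurable_funX.
  by apply: measurable_col_dotv.
have mE : measurable E.
  rewrite -[X in measurable X]setTI.
  exact: (measurable_fun_ltr (measurable_cst _) mf measurableT (Y := [set true])).
have mef : measurable_fun setT (fun w => (expR (a * f w))%:E).
  apply/measurable_EFinP; apply: (measurableT_comp (@measurable_expR R)).
  by apply: measurable_funM.
rewrite -[X in P X]setIT -integral_indic//.
apply: (@le_trans _ _
    (\int[P]_w ((expR (- (a * u ^+ 2)))%:E * (expR (a * f w))%:E))%E).
  apply: ge0_le_integral => //.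
  - exact/measurable_EFinP/measurable_indic.
  - exact: emeasurable_funM.
  move=> w _; rewrite -EFinM lee_fin -expRD addrC -mulrBr indicE.
  have [|_] := boolP (w \in E); last by rewrite expR_ge0.
  rewrite inE /E /= => fw; rewrite -[leLHS]expR0 ler_expR mulr_ge0// subr_ge0.
  exact: ltW.
rewrite ge0_integralZl//.
rewrite EFinM muleC lee_wpmul2r ?lee_fin ?expR_ge0//.
apply: le_trans (integral_expR_sum _ a0 (fun j => exp1 j e e1)) _.
rewrite lee_fin ler_weXn2l ?ler1n// -[leqRHS]card_ord; exact: max_card.
Qed.

Lemma decoupled_tail (a u : R) (S : {set 'I_n}) x : 0 <= a ->
  (forall (j : 'I_n) (e : 'cV[R]_N), dotv e e = 1%R ->
    \int[P]_w (expR (a * dotv (col j (A w)) e ^+ 2))%:E <= 2%:E)%E ->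
  (P [set w | decoupled_bad u S x (A w)] <=
   (2 ^+ n * expR (- (a * u ^+ 2)))%:E)%E.
Proof.
move=> a0 exp1; set c := (_ * _)%:E.
have c0 : (0 <= c)%E by rewrite lee_fin mulr_ge0 ?exprn_ge0 ?expR_ge0.
pose F (M : mtx) : \bar R := (\1_[set M : mtx | decoupled_bad u S x M] M)%:E.
have mB : measurable [set M : mtx | decoupled_bad u S x M].
  exact: (@measurable_decoupled_bad _ mtx id u S x mtx_random_matrix).
have mF : measurable_fun setT F by exact/measurable_EFinP/measurable_indic.
have F0 M : (0 <= F M)%E by rewrite lee_fin.
have mBA := @measurable_decoupled_bad _ _ A u S x mA.
rewrite -[X in P X]setIT -integral_indic//.
rewrite -[leLHS]/(\int[P]_w F (A w))%E (integral_splice mA iA S)//.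
apply: (@le_trans _ _ (\int[P]_w (cst c w))%E); last first.
  rewrite integral_cst// -[leRHS]mule1 lee_wpmul2l//; exact: probability_le1.
apply: ge0_le_integral => //.
- by move=> w _; exact: integral_ge0.
- have mS := splice_random_matrix mA S.
  have mFS : measurable_fun setT
      (fun w : T * T => F (splice S (A w.1) (A w.2) : mtx)).
    by apply: (measurableT_comp mF); exact: random_matrix_measurable.
  exact: (measurable_fun_fubini_tonelli_G _ mFS).
move=> w _; set z := A w *m restr_vec (~: S)%SET x.
apply: le_trans (fixed_vector_tail u S z a0 exp1).
set E := [set w | _].
have mE : measurable E.
  have mf : measurable_fun setT
      (fun w => \sum_(j in S) dotv (col j (A w)) z ^+ 2).
    under eq_fun do rewrite big_mkcond.
    apply: measurable_sum => j; case: (j \in S) => //; apply: measurable_funX.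
    by apply: measurable_col_dotv.
  rewrite -[X in measurable X]setTI.
  exact: (measurable_fun_ltr (measurable_cst _) mf measurableT (Y := [set true])).
rewrite -[X in P X]setIT -integral_indic//.
rewrite le_eqVlt; apply/orP; left; apply/eqP; apply: eq_integral => w' _.
congr (_%:E); rewrite !indicE; congr (_ %:R); congr (nat_of_bool _).
(* The restricted vector vanishes on [S], so the replaced columns do not enter the product. *)
have zE : splice S (A w') (A w) *m restr_vec (~: S)%SET x = z.
  apply/colP => i; rewrite !mxE; apply: eq_bigr => k _; rewrite !mxE inE.
  by case: ifP => //=; rewrite !mulr0.
have badE : decoupled_bad u S x (splice S (A w') (A w)) =
    (u ^+ 2 * dotv z z < \sum_(j in S) dotv (col j (A w')) z ^+ 2).
  rewrite /decoupled_bad zE; congr (_ < _); apply: eq_bigr => j jS.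
  by congr (dotv _ _ ^+ 2); apply/colP => i; rewrite !mxE jS.
by apply/idP/idP; rewrite !inE /E /= badE.
Qed.

End Chaos.

(** * Measurability *)

Section Measurability.
Context {R : realType}.

Lemma cvg_bigsum (I : Type) (r : seq I) (f : I -> R ^nat) (l : I -> R) :
  (forall i, f i m @[m --> \oo] --> l i) ->
  \sum_(i <- r) f i m @[m --> \oo] --> \sum_(i <- r) l i.
Proof.
move=> fl; elim: r => [|i r IH].
  by rewrite big_nil; under eq_cvg do rewrite big_nil; exact: cvg_cst.
rewrite big_cons; under eq_cvg do rewrite big_cons.
exact: cvgD.
Qed.

Lemma cvg_floor_ratio (x : R) :
  (Num.floor (m.+1%:R * x))%:~R / m.+1%:R @[m --> \oo] --> x.
Proof.
have m0 m : 0 < m.+1%:R :> R by rewrite ltr0n.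
apply: (@squeeze_cvgr _ _ _ _ (fun m => x - harmonic m) (cst x)).
- near=> m; rewrite /harmonic/=; apply/andP; split.
    rewrite ler_pdivlMr// mulrBl mulVf ?gt_eqF// (mulrC x) lerBlDr ltW//.
    by have := lt_succ_floor (m.+1%:R * x); rewrite intrD.
  by rewrite ler_pdivrMr// mulrC floor_le.
- by rewrite -[X in _ --> X]subr0; apply: cvgB; [exact: cvg_cst|exact: cvg_harmonic].
- exact: cvg_cst.
Unshelve. all: by end_near. Qed.

(** Approximation of [x] by floor(m x) / m: the factor 1 / m^2 comes out of the form, and
    nonnegativity passes to the limit. *)
Lemma quadratic_ge0_int n (G : 'I_n -> 'I_n -> R) :
  (forall k : {ffun 'I_n -> int},
    0 <= \sum_i \sum_j (k i)%:~R * (k j)%:~R * G i j) ->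
  forall x : 'cV[R]_n, 0 <= \sum_i \sum_j x i 0 * x j 0 * G i j.
Proof.
move=> G0 x.
have m0 m : 0 < m.+1%:R :> R by rewrite ltr0n.
pose y m i : R := (Num.floor (m.+1%:R * x i 0))%:~R / m.+1%:R.
have cv : \sum_i \sum_j y m i * y m j * G i j @[m --> \oo] -->
    \sum_i \sum_j x i 0 * x j 0 * G i j.
  apply: cvg_bigsum => i; apply: cvg_bigsum => j.
  by apply: cvgM; [apply: cvgM; exact: cvg_floor_ratio|exact: cvg_cst].
apply: (cvgr_to_ge cv); near=> m.
have -> : \sum_i \sum_j y m i * y m j * G i j = (m.+1%:R^-1) ^+ 2 *
    \sum_i \sum_j (Num.floor (m.+1%:R * x i 0))%:~R *
      (Num.floor (m.+1%:R * x j 0))%:~R * G i j.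
  rewrite mulr_sumr; apply: eq_bigr => i _; rewrite mulr_sumr.
  by apply: eq_bigr => j _; rewrite /y; ring.
rewrite mulr_ge0 ?sqr_ge0//.
have := G0 [ffun i => Num.floor (m.+1%:R * x i 0)].
by under eq_bigr => i _ do under eq_bigr => j _ do rewrite !ffunE.
Unshelve. all: by end_near. Qed.

(* By homogeneity and continuity it is enough to test integer vectors [x], so
   the event is a countable intersection. *)
Lemma measurable_gram_cone d (T : measurableType d) N n
    (A : T -> 'M[R]_(N, n)) (a b : R) : random_matrix A ->
  measurable [set w | forall x,
    0 <= a * dotv x x + b * dotv (A w *m x) (A w *m x)].
Proof.
move=> mA.
pose F (k : {ffun 'I_n -> int}) := let x : 'cV[R]_n := \col_i (k i)%:~R in
  [set w | 0 <= a * dotv x x + b * dotv (A w *m x) (A w *m x)].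
have mF k : measurable (F k).
  have mq : measurable_fun setT (fun w => let x : 'cV[R]_n := \col_i (k i)%:~R in
      a * dotv x x + b * dotv (A w *m x) (A w *m x)).
    apply: measurable_funD; first exact: measurable_cst.
    by apply: measurable_funM => //; exact: measurable_mulmx_dotv.
  have m0 : measurable_fun setT (fun _ : T => 0 : R) by exact: measurable_cst.
  have := measurable_fun_ler m0 mq measurableT (Y := [set true]).
  by rewrite setTI; apply.
(* Enumerates the integer vectors by natural numbers; codes that decode to nothing impose no
   condition. *)
pose F' m := if @unpickle {ffun 'I_n -> int} m is Some k then F k else setT.
rewrite [X in measurable X](_ : _ = \bigcap_m F' m).
  by apply: bigcapT_measurable => m; rewrite /F'; case: unpickle.
apply/seteqP; split=> w /= h.
  by move=> m _; rewrite /F'; case: unpickle => // k; exact: h.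
have qE x : a * dotv x x + b * dotv (A w *m x) (A w *m x) =
    \sum_i \sum_j x i 0 * x j 0 *
      (a * (i == j)%:R + b * dotv (col i (A w)) (col j (A w))).
  rewrite gram_sum mulr_sumr [b * _]mulr_sumr -big_split; apply: eq_bigr => i _.
  rewrite [b * _]mulr_sumr [in RHS](bigD1 i)//= eqxx [in LHS](bigD1 i)//=.
  rewrite addrA; congr (_ + _); first by ring.
  by apply: eq_bigr => j ji; rewrite eq_sym (negPf ji) mulr0n mulr0 add0r; ring.
move=> x; rewrite qE; apply: quadratic_ge0_int => k.
have := h (pickle k) I; rewrite /F' pickleK /F /= qE => /le_trans; apply.
by apply: ler_sum => i _; apply: ler_sum => j _; rewrite !mxE.
Qed.

End Measurability.

(** * Union bound *)

Lemma measure_bigsetU_le d (T : measurableType d) (R : realType)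
    (P : {measure set T -> \bar R}) (I : Type) (r : seq I) (Q : pred I)
    (F : I -> set T) : (forall i, measurable (F i)) ->
  (P (\big[setU/set0]_(i <- r | Q i) F i) <= \sum_(i <- r | Q i) P (F i))%E.
Proof.
move=> mF; elim: r => [|i r IH]; first by rewrite !big_nil measure0.
rewrite !big_cons; case: ifP => // _.
apply: le_trans (measureU2 _ (mF i) (bigsetU_measurable _ (fun j _ => mF j))) _.
exact: leeD.
Qed.

(** * Measurability and probability of the final events *)

Section Assembly.
Context {R : realType} {N n : nat}.
Context d (T : measurableType d) (P : probability T R).
Variable A : T -> 'M[R]_(N, n).
Hypothesis mA : random_matrix A.

(** Both bounds are conditions on the form |A x|^2; for negative [a] the lower one holds
    automatically, as singular values are nonnegative. *)
Lemma measurable_singular_values (a b : R) : (0 < n)%N -> 0 <= b ->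
  measurable [set w | [/\ a <= s_min (A w), s_min (A w) <= s_max (A w) &
                          s_max (A w) <= b]].
Proof.
move=> n0 b0.
rewrite [X in measurable X](_ : _ =
  (if 0 <= a then [set w | forall x,
      0 <= (- a ^+ 2) * dotv x x + 1 * dotv (A w *m x) (A w *m x)] else setT) `&`
  [set w | forall x,
      0 <= b ^+ 2 * dotv x x + (-1) * dotv (A w *m x) (A w *m x)]).
  apply: measurableI; last exact: measurable_gram_cone.
  by case: ifP => _ //; exact: measurable_gram_cone.
apply/seteqP; split=> w /=.
  move=> [aw _ wb]; split; last first.
    by move=> x; rewrite mulN1r subr_ge0; exact: ((s_max_leP _ n0 b0).1 wb).
  case: ifP => //= a0 x; rewrite mul1r mulNr addrC subr_ge0.
  exact: ((s_min_geP _ n0 a0).1 aw).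
move=> [aw wb]; split.
- move: aw; case: ifPn => [a0 /= aw|a0 _].
    apply/(s_min_geP _ n0 a0) => x.
    by have := aw x; rewrite mul1r mulNr addrC subr_ge0.
  by rewrite (le_trans _ (s_min_ge0 _ n0))// ltW// ltNge.
- exact: s_min_le_s_max.
- by apply/(s_max_leP _ n0 b0) => x; have := wb x; rewrite mulN1r subr_ge0.
Qed.

(** Under a probability every [L^p] norm of [Z] is at most [B], and [p^(-1/2) <= 1] for [p >= 1]. *)
Lemma psi2norm_le_bounded (Z : T -> R) B : measurable_fun setT Z -> 0 <= B ->
  {ae P, forall w, `|Z w| <= B} -> (psi2norm P Z <= B%:E)%E.
Proof.
move=> mZ B0 ZB; apply: ge_ereal_sup => _ [p /= p1 <-].
have p0 : 0 < p by apply: lt_le_trans p1.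
have NB : ('N[P]_p%:E[EFin \o Z] <= B%:E)%E.
  rewrite unlock /=.
  have -> : B%:E = ((B `^ p)%:E `^ p^-1)%E.
    by rewrite poweR_EFin -powRrM mulfV ?gt_eqF// powRr1.
  apply: gt0_ler_poweR.
  - by rewrite invr_ge0 ltW.
  - rewrite in_itv/= leey andbT.
    by apply: integral_ge0 => w _; rewrite lee_fin powR_ge0.
  - by rewrite in_itv/= leey andbT lee_fin powR_ge0.
  apply: (@le_trans _ _ (\int[P]_w (cst (B `^ p)%:E w))%E); last first.
    rewrite integral_cst// -[leRHS]mule1 lee_wpmul2l ?lee_fin ?powR_ge0//.
    exact: probability_le1.
  apply: ae_ge0_le_integral => //.
  - apply/measurable_EFinP; apply: (measurableT_comp (measurable_powR _)).
    exact: measurableT_comp.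
  - by move=> w _; rewrite lee_fin powR_ge0.
  apply: filterS ZB => w ZB _; rewrite lee_fin ge0_ler_powR ?nnegrE// ltW//.
apply: le_trans NB; rewrite -[leRHS]mul1e lee_wpmul2r ?Lnorm_ge0//.
rewrite lee_fin powRN invf_le1 ?powR_gt0// -[X in X <= _](powRr0 p).
by rewrite ler_powR// invr_ge0.
Qed.

Lemma psi2norm_vector_le_norm (j : 'I_n) :
  {ae P, forall w, l2norm (col j (A w)) = Num.sqrt N%:R} ->
  (psi2norm_vector P (fun w => col j (A w)) <= (Num.sqrt N%:R)%:E)%E.
Proof.
move=> normA; apply: ge_ereal_sup => _ [x /= x1 <-].
apply: psi2norm_le_bounded; [|exact: sqrtr_ge0|].
  by apply: measurable_col_dotv.
apply: filterS normA => w Aw.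
rewrite -ler_sqr ?nnegrE ?sqrtr_ge0// real_normK ?num_real//.
apply: le_trans (cauchy_schwarz_sum _ _ _) _.
have sq k (v : 'cV[R]_k) : \sum_i v i 0 ^+ 2 = l2norm v ^+ 2.
  by rewrite sqr_sqrtr ?dotv_ge0//; apply: eq_bigr => i _; rewrite expr2.
by rewrite !sq Aw x1 expr1n mulr1.
Qed.

Hypothesis iA : independent_vectors P (fun j w => col j (A w)).
Hypothesis normA :
  forall j, {ae P, forall w, l2norm (col j (A w)) = Num.sqrt N%:R}.

Definition good_event (u : R) : set T :=
  [set w | (forall j, dotv (col j (A w)) (col j (A w)) = N%:R) /\
    forall g : grid n, g \in net n -> forall S,
      ~~ decoupled_bad u S (grid_vec g) (A w)].

(** Union bound: the exponent [68 * n] is [66 * n] for the net, [n] for the sets [S], and [n] from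
    the tail bound. The norm conditions fail only on null sets. *)
Lemma good_event_prob (a u : R) : 0 <= a ->
  (forall (j : 'I_n) (e : 'cV[R]_N), dotv e e = 1%R ->
    \int[P]_w (expR (a * dotv (col j (A w)) e ^+ 2))%:E <= 2%:E)%E ->
  measurable (good_event u) /\
  (P (~` good_event u) <= (2 ^+ (68 * n) * expR (- (a * u ^+ 2)))%:E)%E.
Proof.
move=> a0 exp1.
pose NC (j : 'I_n) := [set w | dotv (col j (A w)) (col j (A w)) != N%:R].
pose BD (p : grid n * {set 'I_n}) :=
  [set w | decoupled_bad u p.2 (grid_vec p.1) (A w)].
have mNC j : measurable (NC j).
  have mc : measurable_fun setT (fun w => dotv (col j (A w)) (col j (A w))).
    apply: measurable_col_dotv => // i.
    by under eq_fun do rewrite mxE; exact: mA.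
  rewrite [X in measurable X](_ : _ =
    ~` ((fun w => dotv (col j (A w)) (col j (A w))) @^-1` [set N%:R])).
    by apply: measurableC; rewrite -[X in measurable X]setTI; exact: mc.
  by apply/seteqP; split=> w /= /eqP.
have PNC j : P (NC j) = 0%E.
  apply: measure_negligible => //; have := normA j.
  apply: negligibleS => w /= nc Aw; move/eqP: nc; apply.
  by rewrite -[LHS]sqr_sqrtr ?dotv_ge0// -/(l2norm _) Aw sqr_sqrtr.
have mBD p : measurable (BD p) by exact: measurable_decoupled_bad.
have PBD p : (P (BD p) <= (2 ^+ n * expR (- (a * u ^+ 2)))%:E)%E.
  exact: (decoupled_tail mA iA u p.2 (grid_vec p.1) a0 exp1).
pose U := \big[setU/set0]_j NC j `|` \big[setU/set0]_(p | p.1 \in net n) BD p.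
have mU : measurable U.
  by apply: measurableU; apply: bigsetU_measurable.
have E : good_event u = ~` U.
  rewrite /U -bigcup_seq -bigcup_seq_cond setCU; apply/seteqP; split=> w /=.
    move=> [normw goodw]; split=> -[].
      by move=> j _; rewrite /NC /= normw eqxx.
    by move=> [g S] /andP[_ /= gn]; rewrite /BD /=; apply/negP; exact: goodw.
  move=> [nNC nBD]; split=> [j|g gn S].
    by apply/eqP; apply: contra_notT nNC => ncj; exists j => //=; exact: mem_index_enum.
  by apply: contra_notN nBD => bd; exists (g, S) => //=; rewrite mem_index_enum.
rewrite E; split; first exact: measurableC.
rewrite setCK; apply: le_trans (measureU2 _ _ _) _.
- exact: bigsetU_measurable.
- exact: bigsetU_measurable.
have hN : (P (\big[setU/set0]_j NC j) <= 0)%E.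
  apply: le_trans (measure_bigsetU_le _ _ _ mNC) _.
  by rewrite big1 // => j _; exact: PNC.
rewrite -[leRHS]add0e; apply: leeD hN _.
apply: le_trans (measure_bigsetU_le _ _ _ mBD) _.
apply: le_trans (lee_sum _ (fun p _ => PBD p)) _.
rewrite sumEFin lee_fin.
rewrite (eq_bigl (fun p => p \in finset.setX (net n) finset.setT)) => [|p]; last first.
  by case: p => g S; rewrite finset.in_setX finset.in_setT andbT.
rewrite sumr_const -[leLHS]mulr_natl mulrA ler_wpM2r ?expR_ge0//.
rewrite cardsX -powersetT card_powerset cardsT card_ord natrM -mulrA natrX -exprD.
have -> : (68 * n = 66 * n + (n + n))%N by rewrite addnn -mul2n -mulnDl.
by rewrite [leRHS]exprD ler_wpM2r ?exprn_ge0// card_net.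
Qed.

End Assembly.

(** * Choice of the constants and conclusion *)

Theorem theorem5p58 (R : realType) (K : \bar R) :
  exists C c : R, [/\ 0 < C, 0 < c &
    forall (N n : nat) (d : measure_display) (T : measurableType d)
      (P : probability T R) (A : T -> 'M[R]_(N, n)),
      (0 < n)%N -> (n <= N)%N ->
      random_matrix A ->
      independent_vectors P (fun j w => col j (A w)) ->
      (forall j, subgaussian_vector P (fun w => col j (A w))) ->
      (forall j, isotropic P (fun w => col j (A w))) ->
      (forall j, {ae P, forall w, l2norm (col j (A w)) = Num.sqrt N%:R}) ->
      K = \big[maxe/-oo%E]_(j < n) psi2norm_vector P (fun w => col j (A w)) ->
      forall t : R, 0 <= t ->
        ((1 - 2 * expR (- (c * t ^+ 2)))%:E <=
         P [set w |
             [/\ Num.sqrt N%:R - C * Num.sqrt n%:R - t <= s_min (A w),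
                 s_min (A w) <= s_max (A w) &
                 s_max (A w) <= Num.sqrt N%:R + C * Num.sqrt n%:R + t]%R])%E].
Proof.
(* A positive real for every extended [K], and an upper bound of [K] as soon as [K] is finite. *)
pose k := Num.max 1 (fine K).
have k0 : 0 < k by rewrite lt_max ltr01.
pose a := (4 * expR 1 * k ^+ 2)^-1.
have a0 : 0 < a.
  by rewrite /a invr_gt0 mulr_gt0 ?exprn_gt0// mulr_gt0 ?expR_gt0.
(* Chosen so that [a * (C * r / 72) ^+ 2 = 68 * n], which compensates the cardinality factor
   [2 ^+ (68 * n)]. *)
pose C := Num.sqrt (68 * 72 ^+ 2 / a).
have C0 : 0 < C by rewrite sqrtr_gt0 divr_gt0// mulr_gt0.
have C2 : C ^+ 2 = 68 * 72 ^+ 2 / a.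
  by rewrite sqr_sqrtr// divr_ge0 ?(ltW a0)// mulr_ge0.
exists C, (a / 72 ^+ 2); split => //; first by rewrite divr_gt0.
move=> N n d T P A n0 _ mA iA _ _ normA KE t t0.
(* [K] is finite because the columns are bounded. *)
have Kk : (K <= k%:E)%E.
  have : (K <= (Num.sqrt N%:R)%:E)%E.
    rewrite KE; apply: bigmax_le => [|j _]; first exact: leNye.
    exact: psi2norm_vector_le_norm.
  rewrite /k; case: (K) => [r|//|] _; last exact: leNye.
  by rewrite lee_fin le_max lexx orbT.
have exp1 (j : 'I_n) (e : 'cV[R]_N) : dotv e e = 1 ->
    (\int[P]_w (expR (a * dotv (col j (A w)) e ^+ 2))%:E <= 2%:E)%E.
  move=> e1; apply: psi2norm_exp_moment => //; first exact: measurable_col_dotv.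
  apply: le_trans Kk; rewrite KE.
  apply: le_trans (le_bigmax _ (fun j => psi2norm_vector P (fun w => col j (A w))) j).
  apply: ereal_sup_ubound; exists e => //.
  by rewrite /sphere2 /= /l2norm e1 sqrtr1.
set r := Num.sqrt n%:R.
have r0 : 0 <= r by rewrite sqrtr_ge0.
have r2 : r ^+ 2 = n%:R by rewrite sqr_sqrtr.
pose u := (t + C * r) / 72.
have u72 : 72 * u = t + C * r by rewrite /u; field.
have u0 : 0 <= u by rewrite divr_ge0// addr_ge0// mulr_ge0// ltW.
have [mG PG] := good_event_prob mA iA normA u (ltW a0) exp1.
set E := [set w | _].
have mE : measurable E.
  apply: measurable_singular_values => //.
  by rewrite !addr_ge0 ?sqrtr_ge0// mulr_ge0// ltW.
have GE : good_event A u `<=` E.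
  move=> w [normw goodw]; split.
  - have up := gram_lower u0 normw goodw.
    have -> : Num.sqrt N%:R - C * r - t = Num.sqrt N%:R - 72 * u.
      by rewrite u72; ring.
    (* A negative lower bound is trivial because [s_min] is nonnegative. *)
    have [l0|l0] := leP 0 (Num.sqrt N%:R - 72 * u).
      by apply/(s_min_geP _ n0 l0) => x; exact: up.
    by rewrite (le_trans (ltW l0))// s_min_ge0.
  - exact: s_min_le_s_max.
  - have up := gram_upper u0 normw goodw.
    have ub0 : 0 <= Num.sqrt N%:R + 8 * u by rewrite addr_ge0 ?sqrtr_ge0// mulr_ge0.
    apply: (@le_trans _ _ (Num.sqrt N%:R + 8 * u)).
      exact: ((s_max_leP _ n0 ub0).2 up).
    by rewrite -addrA lerD2l (addrC (C * r)) -u72; lra.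
apply: (@le_trans _ _ (P (good_event A u))); last by apply: le_measure; rewrite ?inE.
have PGE : P (good_event A u) = (1 - P (~` good_event A u))%E.
  by rewrite -probability_setC ?setCK//; exact: measurableC.
rewrite PGE EFinB; apply: leeB => //; apply: le_trans PG _; rewrite lee_fin.
(* Replacing base 2 by e turns the cardinality factor into an exponential whose exponent can be
   compared directly. *)
have two : 2 <= expR 1 :> R by apply: le_trans (expR_ge1Dx 1).
apply: (@le_trans _ _ (expR 1 ^+ (68 * n) * expR (- (a * u ^+ 2)))).
  by rewrite ler_wpM2r ?expR_ge0// lerXn2r ?nnegrE ?expR_ge0.
rewrite -expRM_natl mulr1 -expRD.
apply: (@le_trans _ _ (expR (- (a / 72 ^+ 2 * t ^+ 2)))); last first.
  by rewrite ler_peMl ?expR_ge0// ler1n.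
rewrite ler_expR natrM -r2.
have aC : a * C ^+ 2 = 68 * 72 ^+ 2 by rewrite C2; field; rewrite gt_eqF.
(* Expanding the square: the last term cancels the cardinality exponent, the cross term is
   nonnegative, and the first gives the tail in [t]. *)
have -> : a * u ^+ 2 =
    a / 72 ^+ 2 * t ^+ 2 + a / 72 ^+ 2 * (2 * t * (C * r)) + 68 * r ^+ 2.
  rewrite (_ : 68 = a * C ^+ 2 / 72 ^+ 2); last by rewrite aC; field.
  by rewrite /u; field.
have : 0 <= a / 72 ^+ 2 * (2 * t * (C * r)).
  by rewrite mulr_ge0 ?divr_ge0 ?(ltW a0)// !mulr_ge0// ltW.
lra.
Qed.
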